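(* Let $G$ be a finite connected simple graph. Then the matching polytope $P_M(G)$ is Gorenstein if and only if $G$ is one of the following: (a) a bipartite graph all of whose essential vertices have the same degree; (b) the $5$-cycle $C_5$; (c) a graph all of whose essential vertices have degree $3$ and each of whose blocks is bipartite, $K_3$, $K_4$, $K_{1,1,2}$, or $C'_5$.
   Context: For a graph $G$ with edge set $E$, a matching $m\subseteq E$ is identified with its indicator vector in $\mathbb{R}^E$; the matching polytope $P_M(G)\subset\mathbb{R}^E$ is the convex hull of the indicator vectors of all matchings of $G$. A lattice polytope $P\subset\mathbb{R}^d$ is reflexive if both $P$ and its polar dual $P^*=\{y\in\mathbb{R}^d:\langle x,y\rangle\ge -1 \text{ for all } x\in P\}$ are lattice polytopes; $P$ is Gorenstein if there exist $k\in\mathbb{Z}_{>0}$ and $\alpha\in\mathbb{Z}^d$ such that $kP-\alpha$ is reflexive (equivalently, its Ehrhart ring is Gorenstein). A vertex $u$ of $G$ is essential if (1) $\deg_G(u)=1$ and its neighbor also has degree $1$, or (2) $\deg_G(u)=2$ and its two neighbors are not adjacent, or (3) $\deg_G(u)\ge 3$. A block is a maximal connected subgraph without a cut vertex. $K_{1,1,2}$ is the complete multipartite graph with parts of sizes $1,1,2$ (i.e. $K_4$ minus an edge). $C'_5$ is the graph on vertex set $\mathbb{Z}_5$ with edges $\{i,i+1\}$ for $i\in\mathbb{Z}_5$ together with the two chords $\{1,3\},\{2,4\}$. *)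

(* Defs.v *)
From HB Require Import structures.
From mathcomp Require Import all_boot all_order all_algebra.
From mathcomp Require Import boolp classical_sets reals.

Set Implicit Arguments.
Unset Strict Implicit.
Unset Printing Implicit Defensive.

Import Order.TTheory GRing.Theory Num.Theory.

Record sgraph := SGraph {
  vertex :> finType;
  adj : rel vertex;
  adj_sym : symmetric adj;
  adj_irrefl : irreflexive adj
}.
Arguments adj {s} x y.

Section Graphs.
Variable G : sgraph.
Implicit Types u v : G.

Definition deg u : nat := #|[set v | adj u v]%SET|.

Definition essential u : Prop :=
  [\/ deg u = 1 /\ (forall v, adj u v -> deg v = 1),
      deg u = 2 /\ (forall v w, adj u v -> adj u w -> v != w -> ~~ adj v w)
    | 3 <= deg u].

Definition bipartite : Prop :=
  exists c : G -> bool, forall u v, adj u v -> c u != c v.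

Definition num_components : nat := n_comp (@adj G) predT.

(* In particular, a connected graph has at least one vertex. *)
Definition connected_graph : Prop := num_components = 1.

Definition del_adj v : rel {u | u != v} :=
  fun x y => adj (val x) (val y).

Lemma del_adj_sym v : symmetric (@del_adj v).
Proof. by move=> x y; rewrite /del_adj adj_sym. Qed.

Lemma del_adj_irrefl v : irreflexive (@del_adj v).
Proof. by move=> x; rewrite /del_adj adj_irrefl. Qed.

Definition del_vertex v : sgraph :=
  SGraph (@del_adj_sym v) (@del_adj_irrefl v).

End Graphs.

Definition cut_vertex (G : sgraph) (v : G) : Prop :=
  num_components G < num_components (del_vertex v).

Definition graph_iso (G H : sgraph) : Prop :=
  exists f : G -> H, bijective f /\ forall u v, adj (f u) (f v) = adj u v.

(* Not necessarily induced. *)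
Record subgraph (G : sgraph) := Subgraph {
  sub_vertices : {set G};
  sub_adj : rel G;
  sub_adj_sym : symmetric sub_adj;
  sub_adj_adj : forall u v, sub_adj u v -> adj u v;
  sub_adj_vertices : forall u v, sub_adj u v -> u \in sub_vertices
}.

Section Subgraphs.
Variable G : sgraph.
Implicit Types H K : subgraph G.

Definition subgraph_rel H : rel {u | u \in sub_vertices H} :=
  fun x y => sub_adj H (val x) (val y).

Lemma subgraph_rel_sym H : symmetric (@subgraph_rel H).
Proof. by move=> x y; rewrite /subgraph_rel sub_adj_sym. Qed.

Lemma subgraph_rel_irrefl H : irreflexive (@subgraph_rel H).
Proof.
by move=> x; apply/negP => /sub_adj_adj; rewrite adj_irrefl.
Qed.

Definition graph_of_subgraph H : sgraph :=
  SGraph (@subgraph_rel_sym H) (@subgraph_rel_irrefl H).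

Definition subgraph_le H K : Prop :=
  sub_vertices H \subset sub_vertices K /\
  (forall u v, sub_adj H u v -> sub_adj K u v).

Definition connected_no_cut H : Prop :=
  connected_graph (graph_of_subgraph H) /\
  (forall v : graph_of_subgraph H, ~ cut_vertex v).

Definition block H : Prop :=
  connected_no_cut H /\
  (forall K, connected_no_cut K -> subgraph_le H K -> subgraph_le K H).

End Subgraphs.

Definition complete_adj (n : nat) : rel 'I_n := fun i j => i != j.

Lemma complete_adj_sym n : symmetric (@complete_adj n).
Proof. by move=> i j; rewrite /complete_adj eq_sym. Qed.

Lemma complete_adj_irrefl n : irreflexive (@complete_adj n).
Proof. by move=> i; rewrite /complete_adj eqxx. Qed.

Definition complete_graph (n : nat) : sgraph :=
  SGraph (@complete_adj_sym n) (@complete_adj_irrefl n).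

Definition multipartite_vertex (s : seq nat) : finType :=
  {i : 'I_(size s) & 'I_(nth 0 s i)}.

Definition multipartite_adj (s : seq nat) : rel (multipartite_vertex s) :=
  fun x y => tag x != tag y.

Lemma multipartite_adj_sym s : symmetric (@multipartite_adj s).
Proof. by move=> x y; rewrite /multipartite_adj eq_sym. Qed.

Lemma multipartite_adj_irrefl s : irreflexive (@multipartite_adj s).
Proof. by move=> x; rewrite /multipartite_adj eqxx. Qed.

Definition complete_multipartite (s : seq nat) : sgraph :=
  SGraph (@multipartite_adj_sym s) (@multipartite_adj_irrefl s).

Definition cycle5_adj : rel 'Z_5 :=
  fun i j => (j == i + 1)%R || (i == j + 1)%R.

Lemma cycle5_adj_sym : symmetric cycle5_adj.
Proof. by move=> i j; rewrite /cycle5_adj orbC. Qed.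

Lemma cycle5_adj_irrefl : irreflexive cycle5_adj.
Proof. by case=> [[|[|[|[|[|]]]]]]. Qed.

Definition cycle5 : sgraph := SGraph cycle5_adj_sym cycle5_adj_irrefl.

Definition chord (i j : 'Z_5) : bool :=
  ([set i; j] == [set 1%R; 3%R])%SET || ([set i; j] == [set 2%R; 4%R])%SET.

Definition cycle5'_adj : rel 'Z_5 := fun i j => cycle5_adj i j || chord i j.

Lemma cycle5'_adj_sym : symmetric cycle5'_adj.
Proof.
by move=> i j; rewrite /cycle5'_adj /chord cycle5_adj_sym finset.setUC.
Qed.

Lemma cycle5'_adj_irrefl : irreflexive cycle5'_adj.
Proof.
move=> i; rewrite /cycle5'_adj cycle5_adj_irrefl /= /chord finset.setUid.
by apply/norP; split; apply/eqP => /(congr1 (fun A : {set 'Z_5} => #|A|));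
  rewrite cards1 cards2.
Qed.

Definition cycle5' : sgraph := SGraph cycle5'_adj_sym cycle5'_adj_irrefl.

Local Open Scope ring_scope.

Section Polytopes.
Variables (R : realType) (I : finType).

(* [R^o], rather than [R], provides the vector space structure. *)
Local Notation space := {ffun I -> R^o}.

Implicit Types (P A : set space) (x y : space).

Definition inner x y : R := \sum_(i : I) (x i * y i : R).

Definition convex_hull A : set space :=
  [set x | exists (n : nat) (p : 'I_n -> space) (w : 'I_n -> R),
    [/\ forall i, A (p i), forall i, 0 <= w i, \sum_i w i = 1
      & x = \sum_i w i *: p i]]%classic.

Definition lattice_point x : Prop := forall i, (x i : R) \is a Num.int.

Definition lattice_polytope P : Prop :=
  exists s : seq space,
    (forall x, x \in s -> lattice_point x) /\ P = convex_hull [set` s]%classic.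

Definition polar_dual P : set space :=
  [set y | forall x, P x -> inner x y >= -1]%classic.

Definition reflexive_polytope P : Prop :=
  lattice_polytope P /\ lattice_polytope (polar_dual P).

Definition gorenstein P : Prop :=
  exists (k : nat) (a : space), [/\ (0 < k)%N, lattice_point a &
    reflexive_polytope [set k%:R *: x - a | x in P]%classic].

End Polytopes.

Section MatchingPolytope.
Variables (R : realType) (G : sgraph).

Definition edges : {set {set G}} :=
  [set f : {set G} | [exists u, exists v, adj u v && (f == [set u; v])]]%SET.

Definition edge : finType := {f | f \in edges}.

Definition matching (m : {set {set G}}) : Prop :=
  m \subset edges /\ finset.trivIset m.

Definition indicator (m : {set {set G}}) : {ffun edge -> R^o} :=
  [ffun f : edge => (val f \in m)%:R].

Definition matching_polytope : set {ffun edge -> R^o} :=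
  convex_hull [set indicator m | m in matching]%classic.

End MatchingPolytope.
Arguments matching_polytope R G : clear implicits.

(* Main.v *)
(** Let [P] be the matching polytope and suppose that [k P - a] is reflexive.  A facet
    [<n, x> <= b] of [P], where [n] is integral with some entry [1] or [-1], gives the vertex
    [n / (<n, a> - k b)] of the polar dual; it is a lattice point only if [k b - <n, a> = 1].
    The facets [x_e >= 0] then force [a = (1, ..., 1)], an essential vertex [v] forces
    [deg v + 1 = k], and the vertex set [S] of an odd cycle of length [2l+1] forces
    [|E(S)| + 1 = k l].  For a shortest odd cycle [|E(S)| = 2l+1], so [(k - 2) l = 2]: either
    [k = 3] and [G] is a pentagon, or [k = 4] and every non-bipartite block contains a triangle.
    In the latter case all degrees are at most 3, and growing the block from the triangle by ears
    leaves only the listed graphs, because the condition on odd cycles excludes long ears.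

    Conversely, by Edmonds' theorem in dual form, every weight [w] is a nonnegative combination of
    the normals [- x_e], [x(star v)] for [v] essential and [x(E(S))] for [S] 2-connected and
    factor-critical, such that the corresponding combination of right-hand sides is the maximum
    weight [nu w] of a matching.  If all these facets satisfy [k b - <n, 1> = 1], the coefficients
    add up to [k nu(w) - <w, 1>], which is at most [1] when [- w] lies in the polar dual; so the
    polar dual is the convex hull of [0] and of the negated normals. *)

Require Import Defs.
From mathcomp Require Import all_boot all_order all_algebra.
From mathcomp Require Import reals.
From mathcomp Require Import boolp zify ring lra.
From mathcomp Require classical_sets.

Set Implicit Arguments.
Unset Strict Implicit.
Unset Printing Implicit Defensive.

Import Order.TTheory GRing.Theory Num.Theory.

(** * Matchings *)

Section Matchings.
Variable G : sgraph.
Implicit Types (u v : G) (e : {set G}) (m A : {set {set G}}) (S : {set G}).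

Lemma edgesP e : reflect (exists u v, adj u v /\ e = [set u; v]) (e \in edges G).
Proof.
rewrite inE; apply: (iffP existsP) => [[u /existsP[v /andP[a /eqP ->]]]|[u [v [a ->]]]].
  by exists u, v.
by exists u; apply/existsP; exists v; rewrite a /=.
Qed.

Lemma adj_neq u v : adj u v -> u != v.
Proof. by apply: contraTneq => ->; rewrite adj_irrefl. Qed.

Lemma edge_pair u v : ([set u; v] \in edges G) = adj u v.
Proof.
apply/edgesP/idP => [[a [b [ab e]]]|]; last by exists u, v.
have Hu : u \in [set a; b] by rewrite -e !inE eqxx.
have Hv : v \in [set a; b] by rewrite -e !inE eqxx orbT.
have Ha : a \in [set u; v] by rewrite e !inE eqxx.
have Hb : b \in [set u; v] by rewrite e !inE eqxx orbT.
move: Hu Hv Ha Hb; rewrite !inE.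
case/orP=> /eqP->; case/orP=> /eqP->; rewrite ?eqxx ?orbb => //.
- by move=> _ /eqP ba; rewrite ba adj_irrefl in ab.
- by rewrite adj_sym.
- by move=> /eqP ba; rewrite ba adj_irrefl in ab.
Qed.

Lemma card_edge e : e \in edges G -> #|e| = 2.
Proof. by case/edgesP => u [v [/adj_neq uv ->]]; rewrite cards2 uv. Qed.

Definition is_matching m := (m \subset edges G) && trivIset m.

Lemma matchingP m : reflect (matching m) (is_matching m).
Proof. exact: andP. Qed.

Lemma matching0 : is_matching set0.
Proof. by rewrite /is_matching sub0set; apply/trivIsetP => ? ?; rewrite inE. Qed.

Lemma sub_matching m1 m : m1 \subset m -> is_matching m -> is_matching m1.
Proof.
move=> s /andP[a b]; rewrite /is_matching (subset_trans s a) /=.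
exact: trivIsetS b.
Qed.

Lemma matching_edge m e : is_matching m -> e \in m -> e \in edges G.
Proof. by case/andP=> /subsetP s _ /s. Qed.

Lemma matching_eq m e1 e2 v :
  is_matching m -> e1 \in m -> e2 \in m -> v \in e1 -> v \in e2 -> e1 = e2.
Proof.
case/andP=> _ /trivIsetP t m1 m2 v1 v2; apply/eqP; apply/negPn/negP => ne.
by have /disjointFr/(_ v1) := t _ _ m1 m2 ne; rewrite v2.
Qed.

Lemma in_coverP m v : reflect (exists2 e, e \in m & v \in e) (v \in cover m).
Proof. exact: bigcupP. Qed.

Lemma card_cover m : is_matching m -> #|cover m| = 2 * #|m|.
Proof.
move=> mm; have /andP[_ /eqP <-] := mm.
rewrite (eq_bigr (fun=> 2)) => [|e em]; first by rewrite sum_nat_const mulnC.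
exact/card_edge/(matching_edge mm).
Qed.

Lemma cover0 : cover (set0 : {set {set G}}) = set0.
Proof. by rewrite /cover big_set0. Qed.

Lemma cover_pair e m : cover (e |: m) = e :|: cover m.
Proof. by rewrite /cover bigcup_setU big_set1. Qed.

Lemma add_matching m u v : is_matching m -> adj u v ->
  u \notin cover m -> v \notin cover m -> is_matching ([set u; v] |: m).
Proof.
move=> /andP[a b] uv um vm; rewrite /is_matching subUset a sub1set edge_pair uv /=.
apply: trivIsetU => //.
  by apply/trivIsetP => ? ?; rewrite !inE => /eqP-> /eqP->; rewrite eqxx.
rewrite /cover big_set1; apply/pred0P => x /=; rewrite !inE.
apply/negP => /andP[/orP[]/eqP->].
- exact: (negP um).
- exact: (negP vm).
Qed.

Lemma pair_notin m u v : u \notin cover m -> [set u; v] \notin m.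
Proof.
by apply: contra => h; apply/in_coverP; exists [set u; v]; rewrite // !inE eqxx.
Qed.

Definition star v := [set e in edges G | v \in e].
Definition within S := [set e in edges G | e \subset S].

Lemma in_star v e : (e \in star v) = (e \in edges G) && (v \in e).
Proof. by rewrite inE. Qed.

Lemma in_within S e : (e \in within S) = (e \in edges G) && (e \subset S).
Proof. by rewrite inE. Qed.

Lemma star_edges v : star v \subset edges G.
Proof. by apply/subsetP => e; rewrite inE => /andP[]. Qed.

Lemma within_edges S : within S \subset edges G.
Proof. by apply/subsetP => e; rewrite inE => /andP[]. Qed.

Lemma starP v e : reflect (exists2 u, adj v u & e = [set v; u]) (e \in star v).
Proof.
rewrite inE; apply: (iffP andP) => [[/edgesP[a [b [ab ->]]]]|[u vu ->]].
  rewrite !inE => /orP[]/eqP->; first by exists b.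
  by exists a; rewrite 1?adj_sym // setUC.
by rewrite edge_pair !inE eqxx.
Qed.

Lemma set2_inj v a b : v != a -> v != b -> [set v; a] = [set v; b] -> a = b.
Proof.
move=> va vb e; have : a \in [set v; b] by rewrite -e !inE eqxx orbT.
by rewrite !inE eq_sym (negbTE va) => /eqP.
Qed.

Lemma card_star_within v S : v \in S ->
  #|star v :&: within S| = #|[set u in S | adj v u]|.
Proof.
move=> vS; rewrite -(card_in_imset (f := fun u => [set v; u]) (D := [set u in S | adj v u])).
  apply: eq_card => e; rewrite inE; apply/andP/imsetP => [[/starP[u vu ->]]|[u]].
    rewrite inE subUset !sub1set => /and3P[_ _ uS].
    by exists u; rewrite // inE uS.
  rewrite inE => /andP[uS vu] ->; split; first by apply/starP; exists u.
  by rewrite inE edge_pair vu subUset !sub1set vS.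
move=> a b; rewrite !inE => /andP[_ /adj_neq va] /andP[_ /adj_neq vb].
exact: set2_inj.
Qed.

Lemma withinT : within setT = edges G.
Proof. by apply/setP => e; rewrite inE subsetT andbT. Qed.

Lemma card_star v : #|star v| = deg v.
Proof.
rewrite -(setIidPl (star_edges v)) -withinT card_star_within ?inE //.
by apply: eq_card => u; rewrite !inE.
Qed.

Lemma handshake S :
  \sum_(v in S) #|[set u in S | adj v u]| = 2 * #|within S|.
Proof.
rewrite (eq_bigr (fun v => \sum_(e in within S) (v \in e))); last first.
  move=> v vS; rewrite -card_star_within // -big_mkcondr sum1dep_card.
  rewrite /star /within; move: (edges G) => E; apply: eq_card => e; rewrite !inE.
  by case: (e \in E); case: (v \in e); rewrite ?andbF ?andbT.
rewrite exchange_big /= (eq_bigr (fun=> 2)) => [|e]; first by rewrite sum_nat_const mulnC.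
rewrite in_within => /andP[/card_edge <- /subsetP eS]; rewrite -big_mkcondr sum1dep_card.
by apply: eq_card => v; rewrite !inE; case ve: (v \in e); rewrite ?andbF // (eS _ ve).
Qed.

Lemma card_matching_star m v : is_matching m -> #|m :&: star v| = (v \in cover m).
Proof.
move=> mm; case: (in_coverP m v) => [[e em ve]|h]; last first.
  apply/eqP; rewrite cards_eq0 -subset0; apply/subsetP => e;
    rewrite in_setI in_star => /and3P[em _ ve].
  by case: h; exists e.
rewrite -[RHS](cards1 e); apply: eq_card => f; rewrite in_setI in_star in_set1.
apply/and3P/eqP => [[fm _ vf]|->]; first exact: (matching_eq mm fm em vf ve).
by rewrite em ve (matching_edge mm em).
Qed.

Lemma cover_within m S : cover (m :&: within S) \subset S.
Proof.
apply/subsetP => v /in_coverP[e]; rewrite in_setI in_within => /and3P[_ _ /subsetP s]; exact: s.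
Qed.

Lemma card_matching_within m S : is_matching m -> 2 * #|m :&: within S| <= #|S|.
Proof.
move=> mm; rewrite -card_cover; first exact/subset_leq_card/cover_within.
exact: sub_matching (subsetIl _ _) mm.
Qed.

End Matchings.

Section Exchange.
Variable G : sgraph.
Implicit Types (u v t : G) (e : {set G}) (m M N : {set {set G}}) (D : {set G}).

Definition partner m v : G := odflt v [pick u | [set v; u] \in m].

Lemma partner_out m v : v \notin cover m -> partner m v = v.
Proof.
rewrite /partner; case: pickP => //= u um /in_coverP[]; exists [set v; u] => //.
by rewrite !inE eqxx.
Qed.

Lemma partner_edge m e v : is_matching m -> e \in m -> v \in e ->
  e = [set v; partner m v].
Proof.
move=> mm em ve; have /edgesP[a [b [_ eab]]] := matching_edge mm em.
have [w ew] : exists w, e = [set v; w].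
  move: ve; rewrite eab !inE => /orP[]/eqP->; first by exists b.
  by exists a; rewrite setUC.
rewrite /partner; case: pickP => [u um|/(_ w)]; last by rewrite -ew em.
by apply: (matching_eq mm em um ve); rewrite !inE eqxx.
Qed.

Lemma partner_in m v : is_matching m -> v \in cover m -> [set v; partner m v] \in m.
Proof. by move=> mm /in_coverP[e em ve]; rewrite -(partner_edge mm em ve). Qed.

Lemma partnerK m : is_matching m -> involutive (partner m).
Proof.
move=> mm v; case: (boolP (v \in cover m)) => [vm|/partner_out e]; last by rewrite !e.
have pm := partner_in mm vm.
have pe : partner m v \in [set v; partner m v] by rewrite !inE eqxx orbT.
have e := partner_edge mm pm pe.
have vp : partner m v != v.
  by have := matching_edge mm pm; rewrite edge_pair eq_sym => /adj_neq.
apply/esym/(@set2_inj _ (partner m v)); rewrite // 1?setUC //.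
have : partner m (partner m v) != partner m v; last by rewrite eq_sym.
by apply/eqP => h; have := card_edge (matching_edge mm pm); rewrite e h setUid cards1.
Qed.

Section Swap.
Variables (M N : {set {set G}}) (D : {set G}).
Hypotheses (mM : is_matching M) (mN : is_matching N).
Hypothesis MD : forall x, x \in D -> partner M x \in D.
Hypothesis ND : forall x, x \in D -> partner N x \in D.

Lemma edge_inout m e : is_matching m -> (forall x, x \in D -> partner m x \in D) ->
  e \in m -> (e \subset ~: D) = ~~ (e \subset D).
Proof.
move=> mm mD em; have /edgesP[a [b [_ eab]]] := matching_edge mm em.
have ae : a \in e by rewrite eab !inE eqxx.
have be : b \in e by rewrite eab !inE eqxx orbT.
have aD : (a \in D) = (b \in D).
  apply/idP/idP => [/mD|/mD].
    have : b \in [set a; partner m a] by rewrite -(partner_edge mm em ae).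
    by rewrite !inE => /orP[]/eqP->//; rewrite -{2}(partnerK mm a) => /mD.
  have : a \in [set b; partner m b] by rewrite -(partner_edge mm em be).
  by rewrite !inE => /orP[]/eqP->//; rewrite -{2}(partnerK mm b) => /mD.
by rewrite eab !subUset !sub1set !inE aD !andbb.
Qed.

Definition swap := [set e in M | e \subset ~: D] :|: [set e in N | e \subset D].

Lemma swap_matching : is_matching swap.
Proof.
have m1 : is_matching [set e in M | e \subset ~: D].
  by apply: sub_matching mM; apply/subsetP => e; rewrite inE => /andP[].
have m2 : is_matching [set e in N | e \subset D].
  by apply: sub_matching mN; apply/subsetP => e; rewrite inE => /andP[].
apply/andP; split; first by rewrite subUset (andP m1).1 (andP m2).1.
apply: (trivIsetU (andP m1).2 (andP m2).2).
apply/pred0P => x /=; apply/negP => /andP[/in_coverP[e]].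
rewrite inE => /andP[_ /subsetP h] /h; rewrite inE => xD /in_coverP[f].
by rewrite inE => /andP[_ /subsetP h'] /h'; rewrite (negbTE xD).
Qed.

Lemma swap_out v : v \notin D -> v \notin cover M -> v \notin cover swap.
Proof.
move=> vD vM; apply/negP => /in_coverP[e]; rewrite !inE => /orP[]/andP[h /subsetP s] ve.
  by case/in_coverP: vM; exists e.
by rewrite s in vD.
Qed.

Lemma swap_in v : v \in D -> v \notin cover N -> v \notin cover swap.
Proof.
move=> vD vM; apply/negP => /in_coverP[e]; rewrite !inE => /orP[]/andP[h /subsetP s] ve.
  by have := s _ ve; rewrite inE vD.
by case/in_coverP: vM; exists e.
Qed.

End Swap.

Lemma swap_sum M N D e : is_matching M -> is_matching N ->
  (forall x, x \in D -> partner M x \in D) ->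
  (forall x, x \in D -> partner N x \in D) ->
  (e \in swap M N D) + (e \in swap N M D) = (e \in M) + (e \in N).
Proof.
move=> mM mN MD ND; rewrite !inE; have hM := edge_inout mM MD; have hN := edge_inout mN ND.
case: (boolP (e \in M)) => [/hM ->|_]; first by case: (e \subset D); case: (e \in N).
by case: (boolP (e \in N)) => [/hN ->|_] //; case: (e \subset D).
Qed.

Lemma iter_fix (T : Type) (f : T -> T) (x : T) a n :
  iter a f x = x -> iter (n * a) f x = x.
Proof. by move=> h; elim: n => // n IH; rewrite mulSn iterD IH. Qed.

(** The component of [t] in the union of [M] and [N] is the orbit of [t] under [g], the
    composition of the two partner involutions.  As [t] is fixed by [N], the matching [M] maps
    [g^i t] to [g^(-i-1) t], so the orbit has at most one point missed by [M]. *)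
Lemma exchange M N t u v : is_matching M -> is_matching N ->
  t \notin cover N -> u != v -> u \notin cover M -> v \notin cover M ->
  exists M' N', [/\ is_matching M', is_matching N',
    forall e, (e \in M') + (e \in N') = (e \in M) + (e \in N),
    t \notin cover M' & u \notin cover M' \/ v \notin cover M'].
Proof.
move=> mM mN tN uv uM vM.
pose g x := partner N (partner M x).
have pK := partnerK mM; have qK := partnerK mN.
have gI : injective g by apply: inj_comp; exact: inv_inj.
pose D := [set x | fconnect g t x].
have Nt : partner N t = t by exact: partner_out.
have Nit i : partner N (iter i g t) \in D.
  elim: i => [|i IH]; first by rewrite /= Nt inE connect0.
  rewrite iterS {1}/g qK; move: IH; rewrite !inE => IH.
  apply: (connect_trans IH); rewrite fconnect_sym //.
  have -> : partner N (iter i g t) = g (partner M (iter i g t)) by rewrite /g pK.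
  exact: fconnect1.
have ND x : x \in D -> partner N x \in D.
  by rewrite {1}inE => h; rewrite -(iter_findex h).
have MD x : x \in D -> partner M x \in D.
  rewrite {1}inE => h; have := Nit (findex g t x).+1.
  by rewrite iterS (iter_findex h) /g qK.
have fixM i w : iter i g t = w -> w \notin cover M -> iter (2 * i).+1 g t = t.
  move=> iw wM; have gM : forall j, iter j g (partner N (iter j g t)) = t.
    elim=> [|j IH] //; rewrite iterSr iterS; suff -> : g (partner N (g (iter j g t))) =
      partner N (iter j g t) by [].
    by rewrite /g qK pK.
  have gw : g (iter i g t) = partner N (iter i g t) by rewrite {1}/g iw (partner_out wM).
  have -> : (2 * i).+1 = i + i.+1 by lia.
  by rewrite iterD iterS gw gM.
exists (swap M N D), (swap N M D); split; rewrite ?swap_matching //.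
- by move=> e; rewrite swap_sum.
- by apply: swap_in; rewrite // inE connect0.
case: (boolP (u \in D)) => uD; last by left; apply: swap_out.
case: (boolP (v \in D)) => vD; last by right; apply: swap_out.
move: uD vD; rewrite !inE => /iter_findex; set i := findex _ _ _ => iu.
move=> /iter_findex; set j := findex _ _ _ => jv.
have fi := fixM _ _ iu uM; have fj := fixM _ _ jv vM.
case/negP: uv; apply/eqP; rewrite -iu -jv.
have key : forall a b, a <= b -> iter (2 * a).+1 g t = t -> iter (2 * b).+1 g t = t ->
    iter a g t = iter b g t.
  move=> a b ab fa fb; have f2 : iter (2 * (b - a)) g t = t.
    have e : (2 * b).+1 = 2 * (b - a) + (2 * a).+1 by lia.
    by move: fb; rewrite e iterD fa.
  have f1 := iter_fix (b - a) fa.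
  have e : (b - a) * (2 * a).+1 = (b - a) + a * (2 * (b - a)) by nia.
  move: f1; rewrite e iterD (iter_fix a f2) => f1.
  by rewrite -(subnKC ab) iterD f1.
by have [ij|/ltnW ij] := leqP i j; [|symmetry]; apply: key.
Qed.

End Exchange.

(** * Edmonds' theorem *)

Section Optimal.
Variables (R : realDomainType) (G : sgraph).
Implicit Types (u v t : G) (e : {set G}) (m M N : {set {set G}}) (S : {set G}).
Implicit Types (x : {set G} -> R).

Definition wt x m : R := (\sum_(e in m) x e)%R.

Definition optimal x m := is_matching m /\ forall m', is_matching m' -> (wt x m' <= wt x m)%R.

(** [S] is factor-critical and not a singleton. *)
Definition critical S :=
  1 < #|S| /\ forall v, v \in S -> exists2 m, is_matching m & cover m = S :\ v.

Definition tight_set x S := forall m, optimal x m -> (2 * #|m :&: within S|).+1 = #|S|.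

Lemma wtE x m : wt x m = (\sum_e x e *+ (e \in m))%R.
Proof.
rewrite /wt big_mkcond; apply: eq_bigr => e _.
by case: (e \in m); rewrite ?mulr1n.
Qed.

Lemma wt_exchange x M N M' N' :
  (forall e, (e \in M') + (e \in N') = (e \in M) + (e \in N)) ->
  (wt x M' + wt x N' = wt x M + wt x N)%R.
Proof.
move=> h; rewrite !wtE -!big_split; apply: eq_bigr => e _ /=.
by rewrite -!mulrnDr h.
Qed.

Lemma wt_add x m e : e \notin m -> (wt x (e |: m) = x e + wt x m)%R.
Proof. by move=> h; rewrite /wt big_setU1. Qed.

Lemma critical_card S : critical S -> exists l, 0 < l /\ #|S| = l.*2.+1.
Proof.
case=> S1 h; have [v vS] : exists v, v \in S by apply/card_gt0P/ltnW.
have [m mm cm] := h v vS; have := card_cover mm; rewrite cm.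
move: S1; rewrite (cardsD1 v S) vS add1n ltnS => S1 e.
by exists #|m|; rewrite e mul2n; split=> //; rewrite e in S1; lia.
Qed.

Section Positive.
Variable x : {set G} -> R.
Hypothesis x_ge0 : forall e, e \in edges G -> (0 <= x e)%R.

Definition pos_adj : rel G := fun u v => adj u v && (0 < x [set u; v])%R.

Lemma pos_adj_sym : symmetric pos_adj.
Proof. by move=> u v; rewrite /pos_adj adj_sym setUC. Qed.

Lemma pos_adj_cover M u v : optimal x M -> pos_adj u v ->
  u \notin cover M -> v \notin cover M -> False.
Proof.
move=> [mM oM] /andP[uv xuv] uM vM; have := oM _ (add_matching mM uv uM vM).
by rewrite wt_add ?pair_notin // gerDr leNgt xuv.
Qed.

Hypothesis missed : forall v, exists2 m, optimal x m & v \notin cover m.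

(** Lovász's argument: move along the path from [u] to [v], exchanging [M] with an optimal matching
    that misses the next vertex [t]. *)
Lemma missed_once p u v M : path pos_adj u p -> last u p = v -> u != v ->
  optimal x M -> u \notin cover M -> v \notin cover M -> False.
Proof.
elim: p u M => [|t p IH] u M /=; first by move=> _ ->; rewrite eqxx.
case/andP=> ut pt lt uv oM uM vM.
case: (eqVneq t v) => [tv|tv]; first by rewrite -tv in vM; exact: pos_adj_cover ut uM vM.
have [N oN tN] := missed t.
have [M' [N' [mM' mN' hs tM' uvM']]] := exchange oM.1 oN.1 tN uv uM vM.
have oM' : optimal x M'.
  split=> // m mm; apply: (le_trans (oM.2 _ mm)).
  by rewrite -(lerD2r (wt x N')) (wt_exchange x hs) lerD2l oN.2.
case: uvM' => h; first exact: pos_adj_cover oM' ut h tM'.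
exact: IH pt lt tv oM' tM' h.
Qed.

Definition pos_part M := [set e in M | (0 < x e)%R].

Lemma pos_part_sub M : pos_part M \subset M.
Proof. by apply/subsetP => e; rewrite inE => /andP[]. Qed.

Lemma pos_part_optimal M : optimal x M -> optimal x (pos_part M).
Proof.
move=> [mM oM]; split; first exact: sub_matching (pos_part_sub M) mM.
move=> m /oM h; apply: (le_trans h); rewrite /wt (bigID (fun e => 0 < x e)%R) /=.
rewrite [X in (_ + X)%R]big1; last first.
  move=> e /andP[em]; rewrite -leNgt => h0; apply/eqP.
  by rewrite eq_le h0 x_ge0 // (matching_edge mM em).
rewrite addr0 le_eqVlt; apply/orP; left; apply/eqP; apply: eq_bigl => e.
by rewrite inE.
Qed.

Lemma critical_component a b : pos_adj a b ->
  exists2 S, critical S & tight_set x S.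
Proof.
move=> ab; pose S := [set c | connect pos_adj a c].
have cs : connect_sym pos_adj by apply: sym_connect_sym; exact: pos_adj_sym.
have aS : a \in S by rewrite inE connect0.
have once u v M : u \in S -> v \in S -> u != v -> optimal x M ->
    u \notin cover M -> v \notin cover M -> False.
  rewrite !inE => au av uv oM; have : connect pos_adj u v by rewrite (connect_trans _ av) // cs.
  by case/connectP => p pp lp; apply: (missed_once pp).
have inS M e v : optimal x M -> e \in pos_part M -> v \in e -> v \in S -> e \in within S.
  move=> [mM _]; rewrite inE in_within => /andP[eM xe] ve vS.
  rewrite (matching_edge mM eM) /=.
  have /edgesP[c [d [cd ecd]]] := matching_edge mM eM.
  have pcd : pos_adj c d by rewrite /pos_adj cd -ecd.
  have h : (c \in S) = (d \in S) by rewrite !inE (same_connect_r cs (connect1 pcd)).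
  move: ve; rewrite ecd !inE subUset !sub1set => /orP[]/eqP e1.
    by rewrite -h -e1 vS.
  by rewrite h -e1 vS.
pose K M := pos_part M :&: within S.
have covK M : optimal x M -> cover (K M) = cover (pos_part M) :&: S.
  move=> oM; apply/setP => v; rewrite inE; apply/in_coverP/andP.
    case=> e; rewrite inE => /andP[eM eS] ve; split; first by apply/in_coverP; exists e.
    by move: eS; rewrite in_within => /andP[_ /subsetP]; exact.
  case=> /in_coverP[e eM ve] vS; exists e => //; rewrite inE eM /=.
  exact: inS oM eM ve vS.
have mK M : optimal x M -> is_matching (K M).
  by move=> [mM _]; apply: sub_matching mM; apply: subset_trans (pos_part_sub M); apply: subsetIl.
have near v : v \in S -> exists2 M, optimal x M & cover (K M) = S :\ v.
  move=> vS; have [M oM vM] := missed v; exists M => //; rewrite covK //.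
  have vM' : v \notin cover (pos_part M).
    apply: contra vM => /in_coverP[e eM ve]; apply/in_coverP; exists e => //.
    exact: (subsetP (pos_part_sub M)).
  apply/setP => u; rewrite in_setI in_setD1; case uS : (u \in S); rewrite ?andbF ?andbT //.
  case: (eqVneq u v) => [->|uv] /=; first exact: negbTE.
  apply/negPn/negP => uM.
  exact: once uS vS uv (pos_part_optimal oM) uM vM'.
exists S.
  split; last by move=> v /near[M oM cM]; exists (K M); first exact: mK.
  apply: (@leq_trans #|[set a; b]|).
    by rewrite cards2 adj_neq //; case/andP: ab.
  by apply: subset_leq_card; rewrite subUset !sub1set aS inE connect1.
move=> M oM; have [N oN cN] := near a aS.
have oddS : #|S| = (2 * #|K N|).+1.
  by rewrite (cardsD1 a S) aS -cN (card_cover (mK _ oN)).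
have up := card_matching_within S oM.1.
have KM : #|K M| <= #|M :&: within S|.
  by apply: subset_leq_card; apply: setSI; exact: pos_part_sub.
suff : #|S| <= (2 * #|K M|).+1 by lia.
rewrite -(card_cover (mK _ oM)) covK // -(cardsID (cover (pos_part M)) S) setIC -addn1 leq_add2l.
rewrite leqNgt; apply/negP => /card_gt1P[u [v [+ + uv]]]; rewrite !in_setD.
move=> /andP[uM uS] /andP[vM vS].
exact: once uS vS uv (pos_part_optimal oM) uM vM.
Qed.

End Positive.
End Optimal.

Definition restr (T : finType) (e : rel T) (X : {set T}) : rel T :=
  fun a b => [&& e a b, a \in X & b \in X].

Definition connected_on (T : finType) (e : rel T) (X : {set T}) : Prop :=
  forall a b, a \in X -> b \in X -> connect (restr e X) a b.

Definition noncut (T : finType) (e : rel T) (X : {set T}) : Prop :=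
  connected_on e X /\ forall v, v \in X -> connected_on e (X :\ v).

Section Components.
Variable G : sgraph.
Implicit Types (a b c d u v t : G) (e : {set G}) (m M N : {set {set G}}) (S D : {set G}).

Lemma cover_closed m S D : is_matching m -> cover m \subset S ->
  (forall c d, c \in D -> adj c d -> d \in S -> d \in D) ->
  cover (m :&: within D) = cover m :&: D.
Proof.
move=> mm /subsetP mS cl; apply/setP => v; rewrite in_setI; apply/in_coverP/andP.
  case=> e; rewrite in_setI in_within => /and3P[em _ /subsetP eD] ve.
  by split; [apply/in_coverP; exists e|exact: eD].
case=> /in_coverP[e em ve] vD; exists e; rewrite // in_setI em in_within.
have eE := matching_edge mm em; rewrite eE /=.
have : e \in star v by rewrite in_star eE.
case/starP => u vu eu; rewrite eu subUset !sub1set vD /=.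
apply: cl vD vu _; apply: mS; apply/in_coverP; exists e => //.
by rewrite eu !inE eqxx orbT.
Qed.

Definition comp_on S a := [set c in S | connect (restr adj S) a c].

Lemma comp_on_closed S a c d : c \in comp_on S a -> adj c d -> d \in S -> d \in comp_on S a.
Proof.
rewrite !inE => /andP[cS ac] cd dS; rewrite dS /=.
by apply: (connect_trans ac); apply: connect1; rewrite /restr cd cS.
Qed.

Lemma critical_connected S : critical S -> connected_on adj S.
Proof.
case=> _ cr a b aS bS; apply/negPn/negP => nab.
pose D := comp_on S a.
have even m : is_matching m -> cover m \subset S -> ~~ odd #|cover m :&: D|.
  move=> mm ms; rewrite -(cover_closed mm ms (@comp_on_closed S a)) card_cover.
    by rewrite oddM.
  exact: sub_matching (subsetIl _ _) mm.
have aD : a \in D by rewrite inE aS connect0.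
have bD : b \notin D by rewrite inE bS.
have DS : D \subset S by apply/subsetP => c; rewrite inE => /andP[].
have [ma mma cma] := cr a aS; have [mb mmb cmb] := cr b bS.
have := even ma mma; have := even mb mmb; rewrite cma cmb !subD1set.
have -> : (S :\ b) :&: D = D.
  apply/setIidPr/subsetP => c cD; rewrite in_setD1 (subsetP DS) // andbT.
  by apply: contraNneq bD => <-.
have -> : (S :\ a) :&: D = D :\ a.
  by rewrite setIDAC (setIidPr DS).
by rewrite (cardsD1 a D) aD /= negbK => /(_ isT) h /(_ isT); rewrite h.
Qed.

(** If [v] is a cut vertex of [S], then [S'] is [v] together with one component of [S :\ v]: a
    near-perfect matching of [S] is near-perfect on both sides of [v]. *)
Lemma critical_reduce S v a b : critical S -> v \in S -> a \in S :\ v -> b \in S :\ v ->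
  ~~ connect (restr adj (S :\ v)) a b ->
  exists2 S', critical S' & #|S'| < #|S| /\
    forall m, is_matching m -> (2 * #|m :&: within S|).+1 = #|S| ->
      (2 * #|m :&: within S'|).+1 = #|S'|.
Proof.
move=> cr vS av bv nab; pose D := comp_on (S :\ v) a.
have aD : a \in D by rewrite inE av connect0.
have bD : b \notin D by rewrite inE bv.
have DS : D \subset S :\ v by apply/subsetP => c; rewrite inE => /andP[].
have vD : v \notin D by apply: contraL vS => /(subsetP DS); rewrite !inE eqxx.
pose S1 := v |: D; pose S2 := S :\: D.
have S1S : S1 \subset S.
  by rewrite subUset sub1set vS (subset_trans DS) ?subD1set.
have c1 : #|S1| = #|D|.+1 by rewrite cardsU1 vD.
have c2 : #|S| = #|D| + #|S2|.
  rewrite -(cardsID D S); congr (_ + _); congr #|pred_of_set _|.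
  by apply/setIidPr; apply: subset_trans DS (subD1set _ _).
have [l [_ cl]] := critical_card cr.
have evD : ~~ odd #|D|.
  have [mv mmv cmv] := cr.2 v vS; rewrite -(setIidPr DS) -cmv.
  rewrite -(@cover_closed _ (S :\ v)) ?cmv //; last exact: comp_on_closed.
  rewrite card_cover ?oddM //; exact: sub_matching (subsetIl _ _) mmv.
have cnt m : is_matching m -> (2 * #|m :&: within S|).+1 = #|S| ->
   (2 * #|m :&: within S1|).+1 = #|S1|.
  move=> mm ms; have h1 := card_matching_within S1 mm; have h2 := card_matching_within S2 mm.
  suff h : #|m :&: within S| <= #|m :&: within S1| + #|m :&: within S2|.
    by move: c1 c2 cl evD h1 h2 h ms; lia.
  apply: leq_trans (leq_card_setU _ _); apply: subset_leq_card.
  apply/subsetP => e; rewrite in_setI in_within => /and3P[em eE eS].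
  rewrite in_setU !in_setI em !in_within eE /=.
  case: (boolP (e \subset S2)) => [|/subsetPn[c ce]]; rewrite ?orbT // orbF.
  rewrite in_setD (subsetP eS _ ce) andbT negbK => cD.
  have : e \in star c by rewrite in_star eE.
  case/starP => d cd ed; rewrite ed subUset !sub1set !(in_setU1 _ v) cD orbT /=.
  case: eqVneq => //= dv; apply: comp_on_closed cD cd _.
  by rewrite in_setD1 dv (subsetP eS) // ed !inE eqxx orbT.
exists S1; last split => //.
  split; first by rewrite c1 ltnS; apply/card_gt0P; exists a.
  move=> u uS1; have uS := subsetP S1S _ uS1.
  have [mu mmu cmu] := cr.2 u uS; have mm1 := sub_matching (subsetIl mu (within S1)) mmu.
  exists (mu :&: within S1) => //; apply/eqP; rewrite eqEcard; apply/andP; split.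
    apply/subsetP => c cc; rewrite in_setD1 (subsetP (cover_within _ _) _ cc) andbT.
    have : c \in cover mu.
      by case/in_coverP: cc => e; rewrite in_setI => /andP[em _] ce; apply/in_coverP; exists e.
    by rewrite cmu in_setD1 => /andP[].
  rewrite card_cover //; have : (2 * #|mu :&: within S|).+1 = #|S|.
    have -> : mu :&: within S = mu.
      apply/setIidPl/subsetP => e em; rewrite in_within (matching_edge mmu em) /=.
      apply/subsetP => c ce; have : c \in cover mu by apply/in_coverP; exists e.
      by rewrite cmu in_setD1 => /andP[].
    by rewrite -card_cover // cmu (cardsD1 u S) uS.
  by move/(cnt _ mmu); rewrite [in RHS](cardsD1 u) uS1 add1n => -[->].
apply: proper_card; rewrite properE S1S; apply/subsetPn; exists b.
  by move: bv; rewrite in_setD1 => /andP[].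
by rewrite in_setU1 (negbTE bD) orbF; move: bv; rewrite in_setD1 => /andP[].
Qed.

Lemma tight_noncut (R : realDomainType) (x : {set G} -> R) S :
  critical S -> tight_set x S ->
  exists S', [/\ critical S', tight_set x S' & noncut adj S'].
Proof.
have [n] := ubnP #|S|; elim: n S => // n IH S; rewrite ltnS => Sn cr ti.
have [nc|nc] := EM (noncut adj S); first by exists S.
have [v [vS [a [b [aS bS ab]]]]] : exists v, v \in S /\ exists a b,
    [/\ a \in S :\ v, b \in S :\ v & ~~ connect (restr adj (S :\ v)) a b].
  apply: contrapT => no; apply: nc; split; first exact: critical_connected.
  move=> v vS a b av bv; apply: contrapT => nab; apply: no; exists v; split=> //.
  by exists a, b; split=> //; apply/negP.
have [S' cr' [lt h]] := critical_reduce cr vS aS bS ab.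
apply: (IH S') => //; first exact: leq_trans lt Sn.
by move=> m om; apply: h; [case: om|exact: ti].
Qed.

End Components.

Section TightFacet.
Variables (R : realDomainType) (G : sgraph).
Implicit Types (a b c d u v t : G) (e : {set G}) (m M N : {set {set G}}) (S D : {set G}).
Implicit Types (x : {set G} -> R).

Lemma optimal_exists x : exists m, optimal x m.
Proof.
pose m := [arg max_(m > (set0 : {set {set G}}) | is_matching m) wt x m]%O.
exists m; rewrite /m; case: arg_maxP => [|i mi h]; first exact: matching0.
by split=> // m' /h.
Qed.

Lemma neighbor_deg2 v a b : deg v = 2 -> adj v a -> adj v b -> a != b ->
  forall c, adj v c -> c = a \/ c = b.
Proof.
move=> dv va vb ab c vc; have e : [set a; b] = [set u | adj v u].
  by apply/eqP; rewrite eqEcard subUset !sub1set !inE va vb cards2 ab /= -/(deg v) dv.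
have : c \in [set a; b] by rewrite e inE.
by rewrite !inE => /orP[]/eqP; [left|right].
Qed.

Lemma neighbor_deg1 v a : deg v = 1 -> adj v a -> forall c, adj v c -> c = a.
Proof.
move=> dv va c vc; have /eqP/cards1P[b e] := dv.
have : a \in [set b] by rewrite -e inE.
have : c \in [set b] by rewrite -e inE.
by rewrite !inE => /eqP-> /eqP->.
Qed.

Lemma matching1 u v : adj u v -> is_matching [set [set u; v]].
Proof.
move=> uv; rewrite -[[set _]]setU0; apply: add_matching; rewrite ?matching0 //;
by apply/in_coverP => -[e]; rewrite inE.
Qed.

Lemma triangle_critical a b c : adj a b -> adj b c -> adj a c ->
  critical [set a; b; c] /\ #|[set a; b; c]| = 3.
Proof.
move=> ab bc ac; have nab := adj_neq ab; have nbc := adj_neq bc; have nac := adj_neq ac.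
have c3 : #|[set a; b; c]| = 3.
  by rewrite setUC cardsU1 cards2 nab !inE negb_or eq_sym nac eq_sym nbc.
split=> //; split; first by rewrite c3.
move=> v; rewrite !inE -orbA => /or3P[]/eqP->.
- exists [set [set b; c]]; first exact: matching1.
  rewrite /cover big_set1; apply/setP => z; rewrite !inE.
  case: (eqVneq z a) => [->|]; rewrite ?(negbTE nab) ?(negbTE nac) //=.
- exists [set [set a; c]]; first exact: matching1.
  rewrite /cover big_set1; apply/setP => z; rewrite !inE.
  by case: (eqVneq z b) => [->|]; rewrite 1?eq_sym ?(negbTE nab) ?(negbTE nbc) ?orbF //=.
- exists [set [set a; b]]; first exact: matching1.
  rewrite /cover big_set1; apply/setP => z; rewrite !inE.
  case: (eqVneq z c) => [->|]; last by rewrite orbF.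
  by rewrite ![c == _]eq_sym (negbTE nac) (negbTE nbc).
Qed.

Lemma optimal_tight_facet x : (exists2 m, is_matching m & ~ optimal x m) ->
  [\/ exists2 e, e \in edges G & forall m, optimal x m -> e \notin m,
      exists2 v, essential v & forall m, optimal x m -> v \in cover m
    | exists S, [/\ critical S, tight_set x S & noncut adj S]].
Proof.
case=> m0 mm0 nm0; have [m1 om1] := optimal_exists x.
have [[e eE xe]|xpos] := EM (exists2 e, e \in edges G & (x e < 0)%R).
  constructor 1; exists e => // m [mm om]; apply/negP => em.
  have := om (m :\ e) (sub_matching (subD1set _ _) mm).
  by rewrite -{2}(setD1K em) wt_add ?setD11 // lerDr leNgt xe.
have {}xpos e : e \in edges G -> (0 <= x e)%R.
  by move=> eE; rewrite leNgt; apply/negP => xe; apply: xpos; exists e.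
have [[a [b ab]]|zero] := EM (exists a b, pos_adj x a b); last first.
  have w0 m : is_matching m -> wt x m = 0%R.
    move=> mm; rewrite /wt big1 // => e em; have eE := matching_edge mm em.
    apply/eqP; rewrite eq_le xpos // andbT leNgt; apply/negP => xe; apply: zero.
    by have /edgesP[a [b [ab eab]]] := eE; exists a, b; rewrite /pos_adj ab -eab.
  by case: nm0; split=> // m mm; rewrite !w0.
have [miss|] := EM (forall v, exists2 m, optimal x m & v \notin cover m).
  have [S cS tS] := critical_component xpos miss ab.
  by constructor 3; exact: tight_noncut cS tS.
move=> /existsNP[v hv].
have {}hv m : optimal x m -> v \in cover m.
  by move=> om; apply/negPn/negP => vm; apply: hv; exists m.
have [ev|nev] := EM (essential v); first by constructor 2; exists v.
have vnb m : optimal x m -> exists2 u, adj v u & [set v; u] \in m.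
  move=> om; have /in_coverP[e em ve] := hv m om.
  have : e \in star v by rewrite in_star ve (matching_edge om.1 em).
  by case/starP => u vu eu; exists u; rewrite -?eu.
have [u vu um1] := vnb m1 om1.
have dv0 : 0 < deg v by apply/card_gt0P; exists u; rewrite inE.
have dv3 : deg v < 3 by rewrite ltnNge; apply/negP => h; apply: nev; constructor 3.
case: (eqVneq (deg v) 1) => [d1|nd1].
  constructor 2; exists u; last first.
    move=> m om; have [u' vu' um'] := vnb m om; apply/in_coverP; exists [set v; u'] => //.
    by rewrite (neighbor_deg1 d1 vu vu') !inE eqxx orbT.
  have du1 : deg u != 1.
    apply/eqP => du; apply: nev; constructor 1; split=> // w vw.
    by rewrite (neighbor_deg1 d1 vu vw).
  have uv : adj u v by rewrite adj_sym.
  have du0 : 0 < deg u by apply/card_gt0P; exists v; rewrite inE.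
  case: (ltnP 2 (deg u)) => du; first by constructor 3.
  have d2 : deg u = 2 by lia.
  constructor 2; split=> // p q up uq pq; apply/negP => adpq.
  have [e1|e1] := neighbor_deg2 d2 up uq pq uv.
    by have := neighbor_deg1 d1 vu (c := q); rewrite e1 => /(_ adpq) e2;
      rewrite e2 adj_irrefl in uq.
  by have := neighbor_deg1 d1 vu (c := p); rewrite e1 adj_sym => /(_ adpq) e2;
    rewrite e2 adj_irrefl in up.
have d2 : deg v = 2 by lia.
have [a' [b' [va vb a'b' adab]]] : exists a b, [/\ adj v a, adj v b, a != b & adj a b].
  apply: contrapT => no; apply: nev; constructor 2; split=> // p q vp vq pq.
  by apply/negP => adpq; apply: no; exists p, q.
constructor 3; have [cT c3] := triangle_critical va adab vb.
apply: tight_noncut cT _ => m om; have := card_matching_within [set v; a'; b'] om.1.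
rewrite c3; suff : 0 < #|m :&: within [set v; a'; b']| by lia.
have [w vw wm] := vnb m om; apply/card_gt0P; exists [set v; w].
rewrite in_setI wm in_within (matching_edge om.1 wm) subUset !sub1set !inE eqxx /=.
by have [->|->] := neighbor_deg2 d2 va vb a'b' vw; rewrite eqxx ?orbT.
Qed.

End TightFacet.

(** * From the unit condition to reflexivity *)

Section Inner.
Local Open Scope ring_scope.
Variables (R : realType) (I : finType).
Local Notation space := {ffun I -> R^o}.
Implicit Types (x y z : space) (A : classical_sets.set space).

Lemma innerDr x y z : inner x (y + z) = inner x y + inner x z.
Proof. by rewrite /inner -big_split; apply: eq_bigr => i _; rewrite ffunE mulrDr. Qed.

Lemma innerZr x a y : inner x (a *: y) = a * inner x y.
Proof.
by rewrite /inner mulr_sumr; apply: eq_bigr => i _; rewrite ffunE mulrCA.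
Qed.

Lemma innerC x y : inner x y = inner y x.
Proof. by apply: eq_bigr => i _; rewrite mulrC. Qed.

Lemma innerDl x y z : inner (x + y) z = inner x z + inner y z.
Proof. by rewrite innerC innerDr !(innerC z). Qed.

Lemma innerZl a x y : inner (a *: x) y = a * inner x y.
Proof. by rewrite innerC innerZr innerC. Qed.

Lemma innerNr x y : inner x (- y) = - inner x y.
Proof. by rewrite -scaleN1r innerZr mulN1r. Qed.

Lemma innerNl x y : inner (- x) y = - inner x y.
Proof. by rewrite innerC innerNr innerC. Qed.

Lemma inner0r x : inner x 0 = 0.
Proof. by rewrite -(scale0r 0) innerZr mul0r. Qed.

Lemma inner_sumr x (J : finType) (c : J -> R) (p : J -> space) :
  inner x (\sum_j c j *: p j) = \sum_j c j * inner x (p j).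
Proof.
rewrite (big_morph (inner x) (innerDr x) (inner0r x)).
by apply: eq_bigr => j _; rewrite innerZr.
Qed.

Lemma inner_suml (J : finType) (c : J -> R) (p : J -> space) y :
  inner (\sum_j c j *: p j) y = \sum_j c j * inner (p j) y.
Proof. by rewrite innerC inner_sumr; apply: eq_bigr => j _; rewrite innerC. Qed.

Lemma convex_hull_fin A (J : finType) (p : J -> space) (c : J -> R) :
  (forall j, A (p j)) -> (forall j, 0 <= c j) -> \sum_j c j = 1 ->
  convex_hull A (\sum_j c j *: p j).
Proof.
move=> Ap c0 c1; exists #|J|, (fun i => p (enum_val i)), (fun i => c (enum_val i)).
have bij : {on [pred j : J | true], bijective (@enum_val J (mem J))}.
  exists enum_rank => j _; [exact: enum_valK|exact: enum_rankK].
split=> //; first by rewrite -c1 [RHS](reindex _ bij).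
by rewrite [LHS](reindex _ bij).
Qed.

Lemma convex_hull_sub A x : A x -> convex_hull A x.
Proof.
move=> Ax; have := @convex_hull_fin A unit (fun=> x) (fun=> 1).
by rewrite !big_const !card_unit /= !addr0 scale1r; apply.
Qed.

Lemma sum_hull (J : finType) (c : J -> R) (p : J -> space) (k : R) a :
  \sum_j c j = 1 -> k *: (\sum_j c j *: p j) - a = \sum_j c j *: (k *: p j - a).
Proof.
move=> c1; rewrite -{1}[a]scale1r -c1 scaler_suml scaler_sumr -sumrB.
by apply: eq_bigr => j _; rewrite scalerBr !scalerA mulrC.
Qed.

Lemma polar_hull (k : R) a A y :
  polar_dual (classical_sets.image (convex_hull A) (fun x => k *: x - a)) y <->
  forall x, A x -> -1 <= inner (k *: x - a) y.
Proof.
split=> [h x Ax|h _ [x [n [p [c [Ap c0 c1 ->]]]] <-]].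
  by apply: h; exists x => //; exact: convex_hull_sub.
rewrite sum_hull // inner_suml -c1 -sumrN; apply: ler_sum => j _.
by rewrite -{1}[c j]mulr1 -mulrN ler_wpM2l // h.
Qed.

Lemma lattice_polytope_hull (k : nat) a (T : eqType) (s : seq T) (p : T -> space)
    (A : classical_sets.set space) :
  (0 < k)%N -> lattice_point a -> (forall t, lattice_point (p t)) ->
  (forall x, A x <-> exists2 t, t \in s & x = p t) ->
  lattice_polytope (classical_sets.image (convex_hull A) (fun x => k%:R *: x - a)).
Proof.
move=> k0 la lp As; exists [seq k%:R *: p t - a | t <- s].
have ms x : x \in [seq k%:R *: p t - a | t <- s] <-> exists2 t, t \in s & x = k%:R *: p t - a.
  by split=> /mapP.
have kn0 : k%:R != 0 :> R by rewrite pnatr_eq0 -lt0n.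
split.
  move=> x /ms[t _ ->] i; rewrite !ffunE; apply: rpredB; last exact: la.
  by apply: rpredM; [exact: rpred_nat|exact: lp].
apply/classical_sets.seteqP; split=> [_ [x [n [q [c [Aq c0 c1 ->]]]] <-]|
    _ [n [q [c [sq c0 c1 ->]]]]].
  exists n, (fun j => k%:R *: q j - a), c; split=> //; last exact: sum_hull.
  by move=> j; apply/ms; have /As[t st ->] := Aq j; exists t.
have qK j : q j = k%:R *: (k%:R^-1 *: (q j + a)) - a.
  by rewrite scalerA mulfV // scale1r addrK.
exists (\sum_j c j *: (k%:R^-1 *: (q j + a))).
  exists n, (fun j => k%:R^-1 *: (q j + a)), c; split=> // j.
  have /ms[t st ->] := sq j; apply/As; exists t => //.
  by rewrite subrK scalerA mulVf // scale1r.
by rewrite sum_hull //; apply: eq_bigr => j _; rewrite -qK.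
Qed.

End Inner.

Section Weights.
Local Open Scope ring_scope.
Variables (R : realType) (G : sgraph).
Local Notation space := {ffun edge G -> R^o}.
Implicit Types (w y : space) (m A : {set {set G}}).

Definition edge_weight w (e : {set G}) : R := if insub e is Some f then w f else 0.

Lemma edge_weight_val w (f : edge G) : edge_weight w (val f) = w f.
Proof. by rewrite /edge_weight valK. Qed.

Lemma inner_indicator m w : m \subset edges G ->
  inner (indicator R m) w = wt (edge_weight w) m.
Proof.
move=> /subsetP mE; rewrite /wt (eq_bigl (fun e => (e \in edges G) && (e \in m))); last first.
  by move=> e; case em : (e \in m); rewrite ?andbF // mE.
rewrite big_sub_cond /= big_mkcond; apply: eq_bigr => f _.
rewrite edge_weight_val ffunE; case: (_ \in m); rewrite ?mul1r ?mul0r //.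
Qed.

Lemma inner_indicators m A : m \subset edges G ->
  inner (indicator R m) (indicator R A) = #|m :&: A|%:R.
Proof.
move=> mE; rewrite inner_indicator // /wt -sum1_card natr_sum.
rewrite (eq_bigl (fun e => (e \in m) && (e \in A))) => [|e]; last by rewrite in_setI.
rewrite big_mkcondr; apply: eq_bigr => e em.
have [f ef] : exists f : edge G, e = val f.
  by exists (Sub e (subsetP mE _ em)); rewrite SubK.
by rewrite ef edge_weight_val ffunE; case: (_ \in A).
Qed.

Lemma sum_indicator A : A \subset edges G -> \sum_f indicator R A f = #|A|%:R :> R.
Proof.
move=> AE; have := inner_indicators A (subxx (edges G)); rewrite (setIidPr AE) => <-.
apply: eq_bigr => f _; rewrite [indicator R (edges G) f]ffunE.
by case: f => f fE /=; rewrite fE mul1r.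
Qed.

Lemma lattice_indicator A : lattice_point (indicator R A).
Proof. by move=> f; rewrite ffunE rpred_nat. Qed.

Lemma matching_sub m : is_matching m -> m \subset edges G.
Proof. by case/andP. Qed.

End Weights.

Definition unit_condition (G : sgraph) (k : nat) : Prop :=
  (forall v : G, essential v -> (deg v).+1 = k) /\
  (forall (S : {set G}) l, critical S -> noncut adj S -> #|S| = l.*2.+1 ->
     #|within S|.+1 = k * l).

Section Certificate.
Local Open Scope ring_scope.
Variables (R : realType) (G : sgraph).
Local Notation space := {ffun edge G -> R^o}.
Implicit Types (w y : space) (m A : {set {set G}}).

Definition facet : finType := (edge G + G + {set G})%type.

Definition facet_normal (j : facet) : space :=
  match j with
  | inl (inl f) => - indicator R [set val f]
  | inl (inr v) => indicator R (star v)
  | inr X => indicator R (within X)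
  end.

Definition facet_bound (j : facet) : nat :=
  match j with inl (inl _) => 0 | inl (inr _) => 1 | inr X => #|X|./2 end.

Definition unit_facet k j : Prop :=
  (forall m, is_matching m -> inner (indicator R m) (facet_normal j) <= (facet_bound j)%:R) /\
  k%:R * (facet_bound j)%:R - \sum_f facet_normal j f = 1 :> R.

Lemma edge1_sub (f : edge G) : [set val f] \subset edges G.
Proof. by rewrite sub1set; case: f. Qed.

Lemma inner_edge m (f : edge G) : is_matching m ->
  inner (indicator R m) (facet_normal (inl (inl f))) = - (val f \in m)%:R.
Proof.
move=> mm; rewrite innerNr inner_indicators ?matching_sub //.
case: (boolP (val f \in m)) => fm; first by rewrite (setIidPr _) ?cards1 ?sub1set.
by rewrite (disjoint_setI0 _) ?cards0 // disjoint_sym disjoints1.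
Qed.

Lemma inner_star m (v : G) : is_matching m ->
  inner (indicator R m) (facet_normal (inl (inr v))) = (v \in cover m)%:R.
Proof. by move=> mm; rewrite inner_indicators ?matching_sub // card_matching_star. Qed.

Lemma inner_within m (S : {set G}) : is_matching m ->
  inner (indicator R m) (facet_normal (inr S)) = #|m :&: within S|%:R.
Proof. by move=> mm; rewrite inner_indicators ?matching_sub. Qed.

Lemma unit_facet_edge k f : unit_facet k (inl (inl f)).
Proof.
split=> [m mm|]; first by rewrite inner_edge // oppr_le0 ler0n.
rewrite mulr0 add0r (eq_bigr (fun g => - indicator R [set val f] g)); last first.
  by move=> g _; rewrite ffunE.
by rewrite sumrN opprK sum_indicator ?edge1_sub // cards1.
Qed.

Lemma unit_facet_star k v : (deg v).+1 = k -> unit_facet k (inl (inr v)).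
Proof.
move=> dk; split=> [m mm|]; first by rewrite inner_star // ler_nat leq_b1.
by rewrite mulr1 sum_indicator ?star_edges // card_star -dk -addn1 natrD addrC addKr.
Qed.

Lemma unit_facet_within k (S : {set G}) l : #|S| = l.*2.+1 -> (#|within S|.+1 = k * l)%N ->
  unit_facet k (inr S).
Proof.
move=> Sl dk; have bl : #|S|./2 = l by rewrite Sl /= uphalf_double.
split=> [m mm|] /=.
  rewrite inner_within // ler_nat bl; have := card_matching_within S mm.
  by rewrite Sl; lia.
by rewrite bl sum_indicator ?within_edges // -natrM -dk -addn1 natrD addrC addKr.
Qed.

Lemma optimal_tight_unit_facet k w : unit_condition G k ->
  (exists2 m, is_matching m & ~ optimal (edge_weight w) m) ->
  exists j, [/\ unit_facet k j,
    forall m, optimal (edge_weight w) m -> inner (indicator R m) (facet_normal j) = (facet_bound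
      j)%:R
    & exists2 m, is_matching m & inner (indicator R m) (facet_normal j) < (facet_bound j)%:R].
Proof.
move=> [uv uS] /optimal_tight_facet[[e eE he]|[v ev hv]|[S [cS tS nS]]].
- exists (inl (inl (Sub e eE))); split; first exact: unit_facet_edge.
    by move=> m om; rewrite inner_edge ?om.1 // SubK (negbTE (he m om)) oppr0.
  exists [set e]; last by rewrite inner_edge ?SubK ?inE ?eqxx ?ltrN10 //;
    have /edgesP[a [b [ab ->]]] := eE; exact: matching1.
  by have /edgesP[a [b [ab ->]]] := eE; exact: matching1.
- exists (inl (inr v)); split; first exact/unit_facet_star/uv.
    by move=> m om; rewrite inner_star ?om.1 // hv.
  by exists set0; rewrite ?matching0 // inner_star ?matching0 // cover0 inE ltr01.
have [l [l0 Sl]] := critical_card cS.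
have bl : #|S|./2 = l by rewrite Sl /= uphalf_double.
exists (inr S); split; first exact/(unit_facet_within Sl)/uS.
  move=> m om; rewrite inner_within ?om.1 //=; have := tS m om; rewrite bl Sl => h.
  by apply/eqP; rewrite eqr_nat; apply/eqP; move: h; rewrite -mul2n => -[] /eqP;
    rewrite eqn_mul2l => /eqP.
exists set0; first exact: matching0.
by rewrite inner_within ?matching0 // set0I cards0 /= bl ltr0n.
Qed.

Definition nonoptimal w := [set m : {set {set G}} | is_matching m && ~~ `[< optimal (edge_weight
  w) m >]].

(** Subtract from [w] the largest multiple of a tight normal that decreases the maximum weight of a
    matching at the full rate: every optimal matching stays optimal, and a new one becomes so. *)
Lemma dual_certificate k w : unit_condition G k ->
  exists c : facet -> R, [/\ forall j, 0 <= c j, forall j, c j != 0 -> unit_facet k j,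
    w = \sum_j c j *: facet_normal j &
    forall m, optimal (edge_weight w) m ->
      \sum_j c j = k%:R * inner (indicator R m) w - \sum_f w f].
Proof.
move=> uk; have [n] := ubnP #|nonoptimal w|; elim: n w => // n IH w; rewrite ltnS => wn.
have [no|allopt] := EM (exists2 m, is_matching m & ~ optimal (edge_weight w) m); last first.
  have w0 : w = 0.
    apply/ffunP => f; rewrite [RHS]ffunE.
    have opt m : is_matching m -> optimal (edge_weight w) m.
      by move=> mm; apply: contrapT => nm; apply: allopt; exists m.
    have m1 : is_matching [set val f].
      by case: f => f fE /=; have /edgesP[a [b [ab ->]]] := fE; exact: matching1.
    apply/eqP; rewrite eq_le; have := (opt _ m1).2 _ (matching0 G).
    have := (opt _ (matching0 G)).2 _ m1.
    by rewrite /wt big_set1 big_set0 edge_weight_val => -> ->.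
  exists (fun=> 0); split=> //; first by move=> j; rewrite eqxx.
    by rewrite w0 big1 // => j _; rewrite scale0r.
  move=> m _; rewrite w0 inner0r mulr0 !big1 ?subr0 // => f _; by rewrite ffunE.
have [j [gj tj [m1 mm1 sm1]]] := optimal_tight_unit_facet uk no.
have [mo omo] := optimal_exists (edge_weight w).
pose I m := inner (indicator R m).
pose ratio m := (I mo w - I m w) / ((facet_bound j)%:R - I m (facet_normal j)).
pose slack m := is_matching m && (I m (facet_normal j) < (facet_bound j)%:R).
have [m2 [/andP[mm2 sm2] m2min]] : exists m2, slack m2 /\ forall m, slack m -> ratio m2 <= ratio m.
  have sl1 : slack m1 by rewrite /slack mm1.
  exists [arg min_(m < m1 | slack m) ratio m]%O.
  by case: arg_minP => // i si h; split.
have Iw m w' : is_matching m -> I m w' = wt (edge_weight w') m.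
  by move=> mm; rewrite /I inner_indicator ?matching_sub.
have max m : is_matching m -> I m w <= I mo w.
  by move=> mm; rewrite !Iw ?omo.1 //; exact: omo.2.
set t := ratio m2.
have t0 : 0 <= t by rewrite /t /ratio divr_ge0 // subr_ge0 ?max // ltW.
pose w' := w - t *: facet_normal j.
have Iw' m : I m w' = I m w - t * I m (facet_normal j).
  by rewrite /I /w' innerDr innerNr innerZr.
have max' m : is_matching m -> I m w' <= I mo w - t * (facet_bound j)%:R.
  move=> mm; rewrite Iw'; have le := gj.1 _ mm; rewrite -/(I m _) in le.
  case: (ltrP (I m (facet_normal j)) (facet_bound j)%:R) => [lt|ge]; last first.
    have -> : I m (facet_normal j) = (facet_bound j)%:R by apply/eqP; rewrite eq_le le ge.
    by rewrite lerD2r max.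
  have : t <= ratio m by apply: m2min; rewrite /slack mm.
  rewrite /ratio ler_pdivlMr ?subr_gt0 // mulrBr.
  by move: (t * _) (t * _) (I m w) (I mo w) => x1 x2 x3 x4; lra.
have opt' m : is_matching m -> I m w' = I mo w - t * (facet_bound j)%:R ->
  optimal (edge_weight w') m.
  by move=> mm e; split=> // m' mm'; rewrite -!Iw // e max'.
have optsub m : optimal (edge_weight w) m -> I m w' = I mo w - t * (facet_bound j)%:R.
  move=> om; rewrite Iw' [I m (facet_normal j)]tj //; congr (_ - _); apply/eqP.
  by rewrite eq_le max ?om.1 // !Iw ?om.1 ?omo.1 // om.2 // omo.1.
have opt2 : optimal (edge_weight w') m2.
  apply: opt' => //; rewrite Iw' /t /ratio.
  have : (facet_bound j)%:R - I m2 (facet_normal j) != 0 by rewrite subr_eq0 gt_eqF.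
  by move=> h; field.
have nopt2 : ~ optimal (edge_weight w) m2.
  by move/tj => e; move: sm2; rewrite /I e ltxx.
have [|c [c0 cg wc sc]] := IH w'.
  apply: leq_trans wn; apply: proper_card; apply/properP; split.
    apply/subsetP => m; rewrite !inE => /andP[mm /asboolPn nm]; rewrite mm /=.
    by apply/asboolPn => om; apply: nm; apply: opt' => //; exact: optsub.
  exists m2; rewrite inE mm2 /=; first exact/asboolPn.
  by rewrite negbK; apply/asboolP.
exists (fun i => c i + t *+ (i == j)); split.
- by move=> i; rewrite addr_ge0 // mulrn_wge0.
- by move=> i; case: (eqVneq i j) => [->|_] //; rewrite mulr0n addr0; exact: cg.
- under eq_bigr do rewrite scalerDl; rewrite big_split /= -wc (bigD1 j) //= eqxx mulr1n.
  rewrite big1 => [|i /negbTE->]; last by rewrite scale0r.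
  by rewrite addr0 /w' subrK.
move=> m om; rewrite big_split /= (sc m); last by apply: opt'; [case: om|exact: optsub].
have -> : \sum_i t *+ (i == j) = t.
  by rewrite (bigD1 j) //= eqxx mulr1n big1 => [|i /negbTE->//]; rewrite addr0.
rewrite -!/(I m _) Iw' [I m (facet_normal j)]tj //.
have -> : \sum_f w' f = \sum_f w f - t * \sum_f facet_normal j f.
  by rewrite mulr_sumr -sumrB; apply: eq_bigr => f _; rewrite !ffunE.
have := gj.2; set b := (facet_bound j)%:R; set s := \sum_f facet_normal j f => e.
have -> : s = k%:R * b - 1 by move/eqP: e; rewrite subr_eq => /eqP ->; rewrite addrC addKr.
ring.
Qed.

Lemma gorenstein_suff k : (0 < k)%N -> unit_condition G k -> gorenstein (matching_polytope R G).
Proof.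
move=> k0 uk; pose a : space := [ffun=> 1].
have la : lattice_point a by move=> f; rewrite ffunE.
exists k, a; split=> //; split.
  rewrite /matching_polytope; apply: (@lattice_polytope_hull R (edge G) k a _ (enum [set m |
    is_matching m]) (indicator R (G := G))) => //.
    by move=> m; exact: lattice_indicator.
  move=> x; split=> [[m /matchingP mm <-]|[m hm ->]].
    by exists m => //; rewrite mem_enum inE.
  by exists m => //; apply/matchingP; move: hm; rewrite mem_enum inE.
have suma y : inner a y = \sum_f y f by apply: eq_bigr => f _; rewrite ffunE mul1r.
pose s := 0 :: [seq - facet_normal j | j <- enum facet & `[< unit_facet k j >]].
exists s; split.
  have lat j : lattice_point (facet_normal j).
    case: j => [[f|v]|X]; [|exact: lattice_indicator|exact: lattice_indicator].
    move=> g; rewrite /facet_normal ffunE rpredN; exact: (lattice_indicator R [set val f]).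
  move=> x; rewrite inE => /orP[/eqP->|/mapP[j _ ->]] g; first by rewrite ffunE rpred0.
  by rewrite ffunE rpredN; exact: lat.
apply/classical_sets.seteqP; split=> y.
  move/polar_hull => h; have [c [c0 cg wc sc]] := dual_certificate (- y) uk.
  have [m om] := optimal_exists (edge_weight (- y)).
  have := h (indicator R m); have := sc m om.
  rewrite innerDl innerZl !innerNl innerNr suma.
  have -> : \sum_f (- y) f = - \sum_f y f by rewrite -sumrN; apply: eq_bigr => f _; rewrite ffunE.
  move=> e /(_ (ex_intro2 _ _ m (elimT (matchingP m) om.1) erefl)) le.
  have c1 : \sum_j c j <= 1 by rewrite e; lra.
  pose p (j : option facet) := if j is Some i then (if `[< unit_facet k i >] then - facet_normal
    i else 0) else 0.
  pose c' (j : option facet) := if j is Some i then c i else 1 - \sum_j c j.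
  have bigopt (V : nmodType) (F : option facet -> V) : \sum_i F i = F None + \sum_i F (Some i).
    rewrite (bigD1 None) //=; congr (_ + _).
    rewrite (reindex_omap Some id) /=; last by case.
    by apply: eq_bigl => i; rewrite eqxx.
  have -> : y = \sum_i c' i *: p i.
    rewrite bigopt scaler0 add0r -[LHS]opprK wc -sumrN; apply: eq_bigr => i _ /=.
    case: asboolP => [_|ng]; first by rewrite scalerN.
    case: (eqVneq (c i) 0) => [->|/cg //]; by rewrite !scale0r oppr0.
  apply: convex_hull_fin.
  - move=> [i|] /=; rewrite /p; last by rewrite inE eqxx.
    case: asboolP => [gi|_]; last by rewrite inE eqxx.
    rewrite inE; apply/orP; right; apply: (map_f (fun j => - facet_normal j)).
    by rewrite mem_filter mem_enum andbT; apply/asboolP.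
  - by case=> [i|] //=; rewrite subr_ge0.
  - by rewrite bigopt /= subrK.
move=> [n [p [c [ps c0 c1 ->]]]]; apply/polar_hull => x [m /matchingP mm <-].
rewrite inner_sumr -[X in - X <= _]c1 -sumrN; apply: ler_sum => i _.
rewrite -{1}[c i]mulr1 -mulrN ler_wpM2l //; have := ps i; rewrite /= inE => /orP[/eqP->|].
  by rewrite inner0r lerN10.
case/mapP=> j; rewrite mem_filter => /andP[/asboolP[g1 g2] _] ->.
rewrite innerNr lerN2 innerDl innerNl innerZl suma -[leRHS]g2 lerD2r.
by rewrite ler_wpM2l ?ler0n // g1.
Qed.

End Certificate.

(** * Facets of a Gorenstein matching polytope *)

Section Facets.
Local Open Scope ring_scope.
Variables (R : realType) (G : sgraph).
Local Notation space := {ffun edge G -> R^o}.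
Implicit Types (w y z n : space) (m A : {set {set G}}).

Lemma int_ge1 (x : R) : x \is a Num.int -> 0 < x -> 1 <= x.
Proof. by move=> /intrP[z ->]; rewrite ltr0z ler1z. Qed.

Variables (k : nat) (a : space).
Hypotheses (k0 : (0 < k)%N) (la : lattice_point a).
Let Q := polar_dual (classical_sets.image (matching_polytope R G) (fun x => k%:R *: x - a)).
Hypothesis latQ : lattice_polytope Q.

Let kR0 : 0 < k%:R :> R. Proof. by rewrite ltr0n. Qed.

Lemma polar_matching y :
  Q y <-> forall m, is_matching m -> -1 <= k%:R * inner (indicator R m) y - inner a y.
Proof.
rewrite /Q /matching_polytope; split.
  move=> /polar_hull h m /matchingP mm.
  by have := h (indicator R m); rewrite innerDl innerNl innerZl; apply; exists m.
move=> h; apply/polar_hull => x [m /matchingP mm <-].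
by rewrite innerDl innerNl innerZl h.
Qed.

Lemma polar_bounded f : exists B, forall y, Q y -> `|y f| <= B :> R.
Proof.
have [s [_ ->]] := latQ; exists (\sum_(x <- s) `|x f|) => y [n [p [c [ps c0 c1 ->]]]].
rewrite sum_ffunE; apply: (le_trans (ler_norm_sum _ _ _)).
rewrite -[leRHS]mul1r -c1 mulr_suml; apply: ler_sum => i _.
rewrite ffunE normrM (ger0_norm (c0 i)) ler_wpM2l //.
have := ps i; rewrite /= => pi; rewrite (big_rem _ pi) /= lerDl.
by apply: sumr_ge0.
Qed.

(** The hypothesis on [z] says that the matchings on the face span a hyperplane, i.e. that the face
    is a facet. *)
Lemma facet_distance n (b : nat) f0 m0 :
  lattice_point n -> `|n f0| = 1 :> R ->
  (forall m, is_matching m -> inner (indicator R m) n <= b%:R) ->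
  is_matching m0 -> inner (indicator R m0) n = b%:R ->
  (forall z c, (forall m, is_matching m -> inner (indicator R m) n = b%:R ->
       inner (indicator R m) z = c) -> exists l : R, z = l *: n) ->
  k%:R * b%:R - inner a n = 1.
Proof.
move=> ln n1 valid mm0 t0 span; set beta := k%:R * b%:R - inner a n.
have ibeta : beta \is a Num.int.
  rewrite rpredB ?rpredM ?rpred_nat // /inner rpred_sum // => f _.
  by apply: rpredM; [exact: la|exact: ln].
have le_beta m : is_matching m -> k%:R * inner (indicator R m) n - inner a n <= beta.
  by move=> mm; rewrite lerD2r ler_wpM2l ?ler0n // valid.
have beta0 : 0 < beta.
  rewrite ltNge; apply/negP => b0; have [B hB] := polar_bounded f0.
  pose t := `|B| + 1; have t1 : 0 < t by rewrite ltr_wpDl.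
  have /hB : Q (- t *: n).
    apply/polar_matching => m mm; rewrite !innerZr mulrCA -mulrBr mulNr.
    rewrite lerN2; apply: (le_trans _ (@ler01 R)); apply: mulr_ge0_le0; first exact: ltW.
    exact: (le_trans (le_beta m mm) b0).
  rewrite ffunE normrM n1 mulr1 normrN gtr0_norm // /t => h.
  by have := le_trans h (ler_norm B); rewrite gerDl ler10.
have beta1 := int_ge1 ibeta beta0.
have Qy : Q (- beta^-1 *: n).
  apply/polar_matching => m mm; rewrite !innerZr mulrCA -mulrBr mulNr lerN2.
  by rewrite mulrC ler_pdivrMr // mul1r le_beta.
have Qs := Qy; have [s [ls eQ]] := latQ; rewrite eQ in Qs.
have [N [p [c [ps c0 c1 ey]]]] := Qs.
have [i ci] : exists i, 0 < c i.
  apply: contrapT => no; have : \sum_i c i = 0.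
    apply: big1 => i _; apply/eqP; rewrite eq_le c0 andbT leNgt; apply/negP => ci.
    by apply: no; exists i.
  by rewrite c1 => /eqP; rewrite oner_eq0.
have Qp j : Q (p j) by rewrite eQ; apply: convex_hull_sub; exact: ps.
pose val_ m z := k%:R * inner (indicator R m) z - inner a z.
have tight m : is_matching m -> inner (indicator R m) n = b%:R -> val_ m (p i) = -1.
  move=> mm tm; have : val_ m (- beta^-1 *: n) = -1.
    rewrite /val_ !innerZr mulrCA -mulrBr tm -/beta mulNr mulVf //.
    by rewrite gt_eqF.
  rewrite ey => hv; have hs : \sum_j c j * (1 + val_ m (p j)) = 0.
    under eq_bigr do rewrite mulrDr mulr1.
    rewrite big_split /= c1; have -> : \sum_j c j * val_ m (p j) = -1; last by rewrite subrr.
    rewrite -hv /val_ !inner_sumr mulr_sumr -sumrB; apply: eq_bigr => j _.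
    by rewrite mulrBr mulrCA.
  have pos j : 0 <= c j * (1 + val_ m (p j)).
    rewrite mulr_ge0 // -lerBlDl sub0r; exact: (polar_matching (p j)).1.
  have /eqP := hs; rewrite psumr_eq0 // => /allP/(_ i).
  rewrite mem_index_enum mulf_eq0 gt_eqF //= => /(_ isT) /eqP.
  by move/eqP; rewrite addrC addr_eq0 => /eqP.
have [l el] : exists l, p i = l *: n.
  apply: (span _ ((inner a (p i) - 1) / k%:R)) => m mm tm.
  have := tight m mm tm; rewrite /val_ => h; rewrite -h; field; by rewrite gt_eqF.
have lb : l * beta = -1.
  by rewrite -(tight m0 mm0 t0) /val_ el !innerZr t0 mulrCA -mulrBr.
have l1 : 1 <= `|l|.
  apply: int_ge1.
    have := ls _ (ps i) f0; rewrite el ffunE => /intrP[q h].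
    have hq : l * (n f0 : R) = q%:~R by exact: h.
    have -> : `|l| = `|q%:~R : R| by rewrite -hq normrM n1 mulr1.
    by rewrite -intr_norm rpred_int.
  by rewrite normr_gt0; apply: contra_eq_neq lb => ->; rewrite mul0r eq_sym oppr_eq0 oner_eq0.
have : `|l| * beta = 1 by rewrite -{1}(gtr0_norm beta0) -normrM lb normrN1.
move=> e; apply/eqP; rewrite eq_le beta1 andbT -e.
by rewrite -{1}[beta]mul1r ler_wpM2r // ltW.
Qed.

Lemma singleton_matching (f : edge G) : is_matching [set val f].
Proof. by case: f => f fE /=; have /edgesP[u [v [uv ->]]] := fE; exact: matching1. Qed.

Lemma inner_indicator_wt m z : is_matching m -> inner (indicator R m) z = wt (edge_weight z) m.
Proof. by move=> mm; rewrite inner_indicator ?matching_sub. Qed.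

Lemma edge_center f : a f = 1.
Proof.
suff : k%:R * 0%:R - inner a (facet_normal R (inl (inl f))) = 1.
  rewrite mulr0 sub0r innerNr opprK innerC inner_indicator ?edge1_sub //.
  by rewrite /wt big_set1 edge_weight_val.
apply: (@facet_distance _ _ f set0).
- by move=> g; rewrite ffunE rpredN; exact: (lattice_indicator R [set val f]).
- by rewrite /facet_normal !ffunE inE eqxx normrN1.
- by move=> m mm; have [h _] := unit_facet_edge R 0%N f; exact: h.
- exact: matching0.
- by rewrite inner_edge ?matching0 // inE oppr0.
move=> z c h; exists (- z f); apply/ffunP => g; rewrite !ffunE inE.
have c0 : c = 0.
  rewrite -(h set0) ?matching0 ?inner_edge ?matching0 ?inE ?oppr0 //.
  by rewrite inner_indicator_wt ?matching0 // /wt big_set0.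
case: (eqVneq (val g) (val f)) => [/val_inj->|gf];
  first by rewrite scalerN scaleNr opprK /= [RHS]mulr1.
rewrite oppr0 scaler0 -edge_weight_val -c0 -(h [set val g]) ?singleton_matching //.
  by rewrite inner_indicator_wt ?singleton_matching // /wt big_set1.
by rewrite inner_edge ?singleton_matching // inE eq_sym (negbTE gf) oppr0.
Qed.

Lemma inner_center n : inner a n = \sum_f n f.
Proof. by apply: eq_bigr => f _; rewrite edge_center mul1r. Qed.

Lemma scaled_indicator z l A : A \subset edges G ->
  (forall e, e \in edges G -> edge_weight z e = if e \in A then l else 0) ->
  z = l *: indicator R A.
Proof.
move=> AE h; apply/ffunP => f; rewrite !ffunE -edge_weight_val h; last by case: f.
by case: (_ \in A); rewrite ?[RHS]mulr1 ?[RHS]mulr0.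
Qed.

Lemma essential_avoid (v : G) e : essential v -> e \in edges G -> v \notin e ->
  exists2 u, adj v u & u \notin e.
Proof.
move=> ev eE ve; have [p [q [pq epq]]] := edgesP _ eE.
case: ev => [[d1 h]|[d2 h]|d3].
- have [u vu] : exists u, adj v u.
    have /card_gt0P[u] : (0 < deg v)%N by rewrite d1.
    by rewrite inE => vu; exists u.
  exists u => //; apply: contra ve => ue.
  have : e \in star u by rewrite in_star eE.
  case/starP => t ut et; have uv : adj u v by rewrite adj_sym.
  by rewrite et (neighbor_deg1 (h _ vu) ut uv) !inE eqxx orbT.
- apply: contrapT => no; have N u : adj v u -> u \in e.
    by move=> vu; apply/negPn/negP => ue; apply: no; exists u.
  have eN : [set u | adj v u] = e.
    apply/eqP; rewrite eqEcard (card_edge eE) -/(deg v) d2 leqnn andbT.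
    by apply/subsetP => u; rewrite inE; exact: N.
  have pe : p \in e by rewrite epq !inE eqxx.
  have qe : q \in e by rewrite epq !inE eqxx orbT.
  have vp : adj v p by move: pe; rewrite -eN inE.
  have vq : adj v q by move: qe; rewrite -eN inE.
  by have := h p q vp vq (adj_neq pq); rewrite pq.
- have /subsetPn[u] : ~~ ([set u | adj v u] \subset e).
    apply/negP => /subset_leq_card; rewrite (card_edge eE) -/(deg v); lia.
  by rewrite inE => vu ue; exists u.
Qed.

Lemma essential_degree (v : G) : essential v -> (deg v).+1 = k.
Proof.
move=> ev.
have [u0 vu0] : exists u, adj v u.
  have d0 : (0 < deg v)%N by case: ev => [[->]|[->]|] //; lia.
  by have /card_gt0P[u] := d0; rewrite inE => vu; exists u.
have f0E : [set v; u0] \in edges G by rewrite edge_pair.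
have m1 u : adj v u -> is_matching [set [set v; u]] by exact: matching1.
have vin u : v \in [set v; u] by rewrite !inE eqxx.
suff : k%:R * 1%:R - inner a (facet_normal R (inl (inr v))) = 1.
  rewrite inner_center sum_indicator ?star_edges // card_star mulr1.
  by move/eqP; rewrite subr_eq nat1r eqr_nat => /eqP->.
apply: (@facet_distance _ _ (Sub [set v; u0] f0E : edge G) [set [set v; u0]]).
- exact: lattice_indicator.
- by rewrite ffunE SubK in_star f0E vin normr1.
- by move=> m mm; rewrite inner_star // ler_nat leq_b1.
- exact: m1.
- rewrite inner_star ?m1 //; congr (_%:R); apply/eqP; rewrite eqb1.
  by apply/in_coverP; exists [set v; u0]; rewrite ?set11 ?vin.
move=> z c hz; exists c; apply: scaled_indicator (star_edges v) _ => e eE.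
have tz m : is_matching m -> v \in cover m -> wt (edge_weight z) m = c.
  by move=> mm vm; rewrite -inner_indicator_wt // hz // inner_star // vm.
have zu u : adj v u -> edge_weight z [set v; u] = c.
  move=> vu; rewrite -(tz _ (m1 u vu)) /wt ?big_set1 //.
  by apply/in_coverP; exists [set v; u]; rewrite ?set11 ?vin.
case: ifP => [/starP[u vu ->]|]; first exact: zu.
rewrite in_star eE /= => /negbT ve; have [u vu ue] := essential_avoid ev eE ve.
have [p [q [pq epq]]] := edgesP _ eE.
have mm : is_matching (e |: [set [set v; u]]).
  rewrite epq; apply: add_matching => //; rewrite ?m1 // /cover big_set1.
    by apply: contraNN ve; rewrite !inE => /orP[/eqP<-|/eqP pu];
      rewrite epq ?inE ?eqxx //; move: ue; rewrite epq -pu !inE eqxx.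
  by apply: contraNN ve; rewrite !inE => /orP[/eqP<-|/eqP pu];
    rewrite epq ?inE ?eqxx ?orbT //; move: ue; rewrite epq -pu !inE eqxx orbT.
have : v \in cover (e |: [set [set v; u]]).
  by apply/in_coverP; exists [set v; u]; rewrite ?vin // !inE eqxx orbT.
move/(tz _ mm); rewrite wt_add.
  by rewrite /wt big_set1 zu // => /eqP; rewrite -subr_eq0 addrK => /eqP.
by rewrite inE; apply: contraNneq ve => ->.
Qed.

End Facets.

Section Pairs.
Variable G : sgraph.
Implicit Types (x y : G) (s t : seq G).

Fixpoint pairs s : seq {set G} :=
  if s is x :: y :: s' then [set x; y] :: pairs s' else [::].

Fixpoint paired s : bool :=
  if s is x :: y :: s' then adj x y && paired s' else true.

Definition pairing s : {set {set G}} := [set e in pairs s].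

Lemma pair_ind (P : seq G -> Prop) :
  P [::] -> (forall x, P [:: x]) -> (forall x y s, P s -> P (x :: y :: s)) -> forall s, P s.
Proof.
move=> h0 h1 h2 s; have [n] := ubnP (size s); elim: n s => // n IH [|x [|y s]] //= ls.
by apply/h2/IH; lia.
Qed.

Lemma path_paired x s : path adj x s -> paired (x :: s) && paired s.
Proof.
elim: s x => //= y s IH x /andP[xy /IH /andP[h1 h2]].
by rewrite xy h2 h1.
Qed.

Lemma sorted_paired s : sorted adj s -> paired s.
Proof. by case: s => // x s /path_paired/andP[]. Qed.

Lemma pairs_cat s t : ~~ odd (size s) -> pairs (s ++ t) = pairs s ++ pairs t.
Proof. by elim/pair_ind: s => //= x y s IH; rewrite negbK => /IH->. Qed.

Lemma paired_cat s t : ~~ odd (size s) -> paired (s ++ t) = paired s && paired t.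
Proof. by elim/pair_ind: s => //= x y s IH; rewrite negbK => /IH->; rewrite andbA. Qed.

Lemma size_pairs s : size (pairs s) = (size s)./2.
Proof. by elim/pair_ind: s => //= x y s ->. Qed.

Lemma pairing_cons x y s : pairing (x :: y :: s) = [set x; y] |: pairing s.
Proof. by apply/setP => e; rewrite !inE. Qed.

Lemma cover_pairing s : {subset cover (pairing s) <= s}.
Proof.
elim/pair_ind: s => [|x|x y s IH] v; try by case/in_coverP => e; rewrite inE.
by rewrite pairing_cons cover_pair !inE -orbA => /or3P[->|->|/IH->]; rewrite ?orbT.
Qed.

Lemma pairing_matching s : uniq s -> paired s -> is_matching (pairing s).
Proof.
have p0 : is_matching (set0 : {set {set G}}) by exact: matching0.
elim/pair_ind: s => [|x|x y s IH] /=; try by move=> _ _; rewrite (_ : pairing _ = set0) //;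
  apply/setP => e; rewrite !inE.
rewrite inE negb_or => /and3P[/andP[xy xs] ys us] /andP[axy ps]; rewrite pairing_cons.
by apply: add_matching; [exact: IH|done|apply: contra xs|apply: contra ys]; exact: cover_pairing.
Qed.

Lemma pairs_uniq s : uniq s -> uniq (pairs s).
Proof.
elim/pair_ind: s => //= x y s IH; rewrite inE negb_or => /and3P[/andP[xy xs] ys us].
rewrite IH // andbT; apply: contra xs => h; apply: cover_pairing; apply/in_coverP.
by exists [set x; y]; rewrite !inE ?eqxx.
Qed.

Lemma card_pairing s : uniq s -> #|pairing s| = (size s)./2.
Proof. by move=> us; rewrite cardsE (card_uniqP (pairs_uniq us)) size_pairs. Qed.

Lemma pairing_within s (S : {set G}) : uniq s -> paired s -> {subset s <= S} ->
  pairing s \subset within S.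
Proof.
move=> us ps sS; apply/subsetP => e em.
rewrite in_within (matching_edge (pairing_matching us ps) em) /=.
by apply/subsetP => v ve; apply/sS/cover_pairing/in_coverP; exists e.
Qed.

Local Open Scope ring_scope.

Lemma wt_pairing (R : realDomainType) (x : {set G} -> R) s : uniq s ->
  wt x (pairing s) = \sum_(e <- pairs s) x e.
Proof.
move=> us; rewrite [RHS]big_uniq ?pairs_uniq //.
by apply: eq_bigl => e; rewrite inE.
Qed.

End Pairs.

Section OddCycle.
Local Open Scope ring_scope.
Variables (R : realDomainType) (G : sgraph) (x : {set G} -> R) (p : seq G) (l : nat) (c : R).
Let S := [set v in p].

Definition rotation (q : seq G) := [/\ uniq q, cycle adj q, size q = l.*2.+1 & q =i p].

Hypothesis l0 : (0 < l)%N.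
Hypothesis wt_tight : forall m, is_matching m -> #|m :&: within S| = l -> wt x m = c.
Hypothesis pS : #|S| = l.*2.+1.

Lemma rotation_rot i q : rotation q -> rotation (rot i q).
Proof.
case=> uq cq sq qp; split; rewrite ?rot_uniq ?rot_cycle ?size_rot // => v.
by rewrite mem_rot.
Qed.

Lemma tight_bound m : is_matching m -> (l <= #|m :&: within S|)%N -> wt x m = c.
Proof.
move=> mm lm; apply: wt_tight => //; have := card_matching_within S mm; rewrite pS.
by move: lm; lia.
Qed.

Lemma tight_pairing s : uniq s -> paired s -> {subset s <= p} -> size s = l.*2 ->
  \sum_(e <- pairs s) x e = c.
Proof.
move=> us ps sp ss; rewrite -wt_pairing //; apply: tight_bound.
  exact: pairing_matching.
rewrite (setIidPl _) ?card_pairing ?ss ?doubleK //.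
by apply: pairing_within => // v /sp; rewrite inE.
Qed.

Definition first_edge (q : seq G) := if q is a :: b :: _ then x [set a; b] else 0.

Lemma rotation_behead q : rotation q -> \sum_(e <- pairs (behead q)) x e = c.
Proof.
case: q => [[]|a s [us cs ss sp]] //=.
apply: tight_pairing.
- by case/andP: us.
- apply: sorted_paired; move: cs => /= ; rewrite rcons_path => /andP[/path_sorted].
  by [].
- by move=> v vs; rewrite -sp inE vs orbT.
- by case: ss.
Qed.

(** The near-perfect matchings that miss two vertices at distance 2 differ by two consecutive
    edges. *)
Lemma first_edge_rot1 q : rotation q -> first_edge (rot 1 q) = first_edge q.
Proof.
move=> rq; have [uq cq sq qp] := rq.
case: q rq uq cq sq qp => [|a [|b [|d s]]] rq uq cq sq qp //; try by move: sq l0 => /=; lia.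
have := rotation_behead rq; have := rotation_behead (rotation_rot 2 rq).
rewrite /= pairs_cat; last by move: sq => /=; lia.
rewrite big_cat /= !big_cons big_nil addr0 => h2 h1.
by apply: (@addIr _ (\sum_(e <- pairs s) x e)); rewrite /= h1 -h2 addrC.
Qed.

Lemma first_edge_rot i q : rotation q -> first_edge (rot i q) = first_edge q.
Proof.
move=> rq; elim: i => [|i IH]; first by rewrite rot0.
have [h|h] := ltnP i (size q); last by rewrite rot_oversize // (leq_trans h).
by rewrite -IH -add1n rotD // first_edge_rot1 //; exact: rotation_rot.
Qed.

Lemma sum_pairs_infix q s1 t s2 : rotation q -> q = s1 ++ t ++ s2 ->
  \sum_(e <- pairs t) x e = first_edge q *+ (size t)./2.
Proof.
move=> rq; elim/pair_ind: t s1 => [|a|a b t IH] s1 eq; rewrite ?big_nil //.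
rewrite /= big_cons (IH (s1 ++ [:: a; b])) ?eq -?catA // mulrS; congr (_ + _).
by rewrite -eq -(first_edge_rot (size s1) rq) eq rot_size_cat.
Qed.

Lemma first_edge_total q : rotation q -> first_edge q *+ l = c.
Proof.
move=> rq; rewrite -(rotation_behead rq); case: q rq => [[]|a s rq] //.
rewrite (@sum_pairs_infix (a :: s) [:: a] s [::]) ?cats0 //.
by case: rq => _ _ [->] _; rewrite doubleK.
Qed.

(** The chord, a perfect matching of the arc [s1] and a perfect matching of [s2] without its first
    vertex form a near-perfect matching of the cycle. *)
Lemma even_chord_weight q a b s1 s2 : rotation q -> q = a :: s1 ++ b :: s2 -> adj a b ->
  ~~ odd (size s1) -> x [set a; b] = first_edge q.
Proof.
move=> rq eq ab ev; have [uq cq sq qp] := rq.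
have sz : (size s1 + size s2).+2 = l.*2.+1 by rewrite -sq eq /= size_cat /=; lia.
case: s2 eq sz => [|d s2] eq /= sz; first by lia.
have perm : perm_eq q (d :: a :: b :: s1 ++ s2).
  by rewrite eq; apply/permP => P; rewrite /= !count_cat /=; lia.
have sub : {subset a :: b :: s1 ++ s2 <= p}.
  by move=> v vs; rewrite -qp (perm_mem perm) inE vs orbT.
have ps : paired (s1 ++ s2).
  move: cq; rewrite eq /= rcons_path => /andP[+ _].
  rewrite cat_path => /andP[/path_sorted h1 /= /and3P[_ _ /path_sorted h2]].
  by rewrite paired_cat // !sorted_paired.
have ev2 : ~~ odd (size s2) by lia.
have := @tight_pairing (a :: b :: s1 ++ s2); rewrite /= ab ps => /(_ _ isT sub).
rewrite size_cat -(first_edge_total rq) big_cons pairs_cat // big_cat /=.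
rewrite (@sum_pairs_infix q [:: a] s1 (b :: d :: s2)) //.
rewrite (@sum_pairs_infix q (a :: s1 ++ [:: b; d]) s2 [::]) //; last by rewrite eq /= -catA cats0.
have -> : l = ((size s1)./2 + (size s2)./2).+1 by lia.
rewrite mulrS mulrnDr => h; apply: (@addIr _ _ _ _ (h _ _)).
  by move: uq; rewrite (perm_uniq perm) => /andP[].
by lia.
Qed.

Lemma chord_weight q a b : rotation q -> a \in p -> b \in p -> adj a b -> x [set a;
  b] = first_edge q.
Proof.
move=> rq ap bp ab; have [uq cq sq qp] := rq.
have aq : a \in q by rewrite qp.
have [i s es] := rot_to aq; have rs := rotation_rot i rq; rewrite es in rs.
rewrite -(first_edge_rot i rq) es.
have : b \in a :: s by rewrite -es mem_rot qp.
rewrite inE eq_sym (negbTE (adj_neq ab)) orFb => /splitPr bs.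
case: bs rs {es} => s1 s2 rs.
case: (boolP (odd (size s1))) => od; last exact: even_chord_weight rs _ ab od.
rewrite -(first_edge_rot (size (a :: s1)) rs) -cat_cons rot_size_cat setUC.
have rs' := rotation_rot (size (a :: s1)) rs.
rewrite -cat_cons rot_size_cat in rs'.
apply: (even_chord_weight rs') => //; first by rewrite adj_sym.
case: rs => _ _ /(congr1 odd) + _; rewrite /= size_cat /= addnS /= oddD od odd_double.
by case: (odd (size s2)).
Qed.

Lemma outside_edge q a b : rotation q -> adj a b -> a \notin p -> x [set a; b] = 0.
Proof.
move=> rq ab ap; have [uq cq sq qp] := rq.
have [i [d [s [es bs]]]] : exists i d s, rot i q = d :: s /\ (b \notin s).
  case: (boolP (b \in q)) => [/rot_to[i s es]|bq].
    by exists i, b, s; split=> //; move: uq; rewrite -(rot_uniq i) es => /andP[].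
  case: q {rq uq cq qp} sq bq => // d s _; rewrite inE negb_or => /andP[_ bs].
  by exists 0%N, d, s; rewrite rot0.
have rs := rotation_rot i rq; rewrite es in rs; have hs := rotation_behead rs.
have [us cs ss sp] := rs.
have ps : paired s by move: cs; rewrite /= rcons_path => /andP[/path_sorted/sorted_paired].
have asn : a \notin s by apply: contra ap => h; rewrite -sp inE h orbT.
have us' : uniq (a :: b :: s).
  by move: us => /= /andP[_ ->]; rewrite bs inE negb_or asn adj_neq.
have ps' : paired (a :: b :: s) by rewrite /= ab ps.
have := tight_bound (pairing_matching us' ps'); rewrite wt_pairing //= big_cons -[in RHS]hs.
move=> h; apply: (@addIr _ (\sum_(e <- pairs s) x e)); rewrite add0r h //.
have -> : l = #|pairing s| by rewrite card_pairing; [case: ss => ->; rewrite doubleK|case/andP: us].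
apply: subset_leq_card; rewrite subsetI pairing_cons subsetUr /=.
apply: pairing_within => //; first by case/andP: us.
by move=> v vs; rewrite inE -sp inE vs orbT.
Qed.

End OddCycle.

Section Necessary.
Local Open Scope ring_scope.
Variables (R : realType) (G : sgraph) (k : nat) (a : {ffun edge G -> R^o}).
Hypotheses (k0 : (0 < k)%N) (la : lattice_point a).
Hypothesis latQ : lattice_polytope
  (polar_dual (classical_sets.image (matching_polytope R G) (fun x => k%:R *: x - a))).

Lemma odd_cycle_count (p : seq G) : uniq p -> cycle adj p -> odd (size p) ->
  (#|within [set v in p]|.+1 = k * (size p)./2)%N.
Proof.
move=> up cp op; set S := [set v in p]; set l := (size p)./2.
have sp : size p = l.*2.+1 by rewrite -[LHS]odd_double_half op.
have cS : #|S| = l.*2.+1 by rewrite -sp cardsE; exact/card_uniqP.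
have l0 : (0 < l)%N.
  rewrite lt0n; apply/eqP => l0; have : size p = 1%N by rewrite sp l0.
  by case: (p) cp => [|b [|d q]] //=; rewrite adj_irrefl.
have rp : rotation p l p by [].
have sl : #|S|./2 = l by rewrite cS /= uphalf_double.
have [b [d [s ep]]] : exists b d s, p = b :: d :: s.
  by case: (p) sp => [|b [|d s]] /= h; [lia|lia|exists b, d, s].
have bd : adj b d by move: cp; rewrite ep /= => /andP[].
have fE : [set b; d] \in edges G by rewrite edge_pair.
have bp : b \in p by rewrite ep !inE eqxx.
have dp : d \in p by rewrite ep !inE eqxx orbT.
have fS : [set b; d] \in within S by rewrite in_within fE subUset !sub1set !inE bp dp.
have [m0 mm0 cm0] : exists2 m, is_matching m & #|m :&: within S| = l.
  have us : uniq (behead p) by move: up; rewrite ep => /andP[].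
  have ps : paired (behead p).
    apply: sorted_paired; move: cp; rewrite ep /= => /andP[_].
    by rewrite rcons_path => /andP[].
  exists (pairing (behead p)); first exact: pairing_matching.
  rewrite (setIidPl _) ?card_pairing // ?size_behead ?sp ?doubleK //.
  by apply: pairing_within => // v /mem_behead; rewrite inE.
suff : k%:R * l%:R - inner a (facet_normal R (inr S)) = 1.
  rewrite (inner_center k0 la latQ) sum_indicator ?within_edges // -natrM.
  by move/eqP; rewrite subr_eq nat1r eqr_nat => /eqP->.
apply: (@facet_distance _ _ _ _ k0 la latQ _ _ (Sub [set b; d] fE : edge G) m0) => //.
- exact: lattice_indicator.
- by rewrite ffunE SubK fS normr1.
- move=> m mm; rewrite inner_within // ler_nat; have := card_matching_within S mm.
  by rewrite cS; lia.
- by rewrite inner_within // cm0.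
move=> z c hz; exists (first_edge (edge_weight z) p).
apply: scaled_indicator (within_edges S) _ => e eE.
have ti m : is_matching m -> #|m :&: within S| = l -> wt (edge_weight z) m = c.
  by move=> mm hm; rewrite -inner_indicator_wt // hz // inner_within // hm.
have /edgesP[u [v [uv ee]]] := eE; rewrite in_within eE ee subUset !sub1set !inE /=.
case: (boolP (u \in p)) => up' /=; last first.
  exact: (outside_edge l0 ti cS rp uv up').
case: (boolP (v \in p)) => vp /=; last first.
  by rewrite setUC; apply: (outside_edge l0 ti cS rp _ vp); rewrite adj_sym.
exact: (chord_weight l0 ti cS rp).
Qed.

End Necessary.

Lemma gorenstein_necessary (R : realType) (G : sgraph) : gorenstein (matching_polytope R G) ->
  exists2 k, 0 < k & (forall v : G, essential v -> (deg v).+1 = k) /\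
    forall p : seq G, uniq p -> cycle adj p -> odd (size p) ->
      #|within [set v in p]|.+1 = k * (size p)./2.
Proof.
case=> k [a [k0 la [_ latQ]]]; exists k => //; split=> [v|p].
  exact: (essential_degree k0 la latQ).
exact: (odd_cycle_count k0 la latQ).
Qed.

(** * Odd cycles and blocks *)

Section OddWalks.
Variables (T : finType) (e : rel T).
Hypotheses (e_sym : symmetric e) (e_irr : irreflexive e).
Implicit Types (x y : T) (p q s : seq T).

Lemma closed_walk x q : path e x q -> last x q = x -> q != [::] ->
  exists2 p, cycle e p & size p = size q.
Proof.
case/lastP: q => // q y; rewrite last_rcons => h yx _; rewrite yx in h.
by exists (x :: q); rewrite ?size_rcons.
Qed.

(** Colour a vertex by the existence of an even walk from the root of its component. *)
Lemma odd_walk_free_coloring : (forall p, cycle e p -> ~~ odd (size p)) ->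
  exists c : T -> bool, forall u v, e u v -> c u != c v.
Proof.
move=> nodd; have cs : connect_sym e by exact: sym_connect_sym.
pose even v p := [/\ path e (fingraph.root e v) p, last (fingraph.root e v) p = v &
  ~~ odd (size p)].
exists (fun v => `[< exists p, even v p >]) => u v uv.
have er : fingraph.root e u = fingraph.root e v by apply/(fingraph.rootP cs)/connect1.
have key p1 p2 : path e (fingraph.root e u) p1 -> last (fingraph.root e u) p1 = u ->
    path e (fingraph.root e u) p2 -> last (fingraph.root e u) p2 = v ->
      odd (size p1) = odd (size p2) -> False.
  move=> h1 l1 h2 l2 op.
  have w : path e (fingraph.root e u) (p1 ++ v :: rev (belast (fingraph.root e u) p2)).
    rewrite cat_path h1 l1 /= uv -{1}l2 rev_path /=.
    by rewrite (@eq_path _ _ e) // => a b; rewrite e_sym.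
  have [|//|q cq sq] := closed_walk w.
    rewrite last_cat /=; case: (p2) l2 => [/= ->|a p2' _] //.
    by rewrite /= rev_cons last_rcons.
  - by case: (p1).
  have := nodd q cq; rewrite sq size_cat /= size_rev size_belast addnS /= oddD op.
  by rewrite addbb.
have walk w : fingraph.root e w = fingraph.root e u ->
  exists2 p, path e (fingraph.root e u) p & last (fingraph.root e u) p = w.
  move=> rw; have : connect e (fingraph.root e u) w by rewrite -rw cs connect_root.
  by case/connectP => p pp lp; exists p.
have [p1 h1 l1] := walk u erefl; have [p2 h2 l2] := walk v (esym er).
apply/negP => /eqP ec.
have odd_of w p : fingraph.root e w = fingraph.root e u -> path e (fingraph.root e u) p ->
  last (fingraph.root e u) p = w ->
    ~ (exists p, even w p) -> odd (size p).
  move=> rw hp lp no; apply/negPn/negP => ev; apply: no; exists p.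
  by rewrite /even rw.
case: (asboolP (exists p, even u p)) ec => [[q1 [a1 b1 c1]]|nu];
  case: (asboolP (exists p, even v p)) => [[q2 [a2 b2 c2]]|nv] // _.
  rewrite -er in a2 b2; apply: (key q1 q2) => //.
  by rewrite (negbTE c1) (negbTE c2).
apply: (key p1 p2) => //; rewrite (odd_of u p1) // (odd_of v p2) //.
Qed.

Section Minimal.
Variable p : seq T.
Hypotheses (cp : cycle e p) (op : odd (size p)).
Hypothesis min : forall q, cycle e q -> odd (size q) -> size p <= size q.

Lemma minimal_rot i x s1 y s2 : rot i p = x :: s1 ++ y :: s2 ->
  [/\ path e x s1, e (last x s1) y, path e y s2, e (last y s2) x &
    size p = (size s1 + size s2).+2].
Proof.
move=> er; have : cycle e (x :: s1 ++ y :: s2) by rewrite -er rot_cycle.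
rewrite /= rcons_cat cat_path /= rcons_path => /and4P[h1 h2 h3 h4]; split=> //.
by rewrite -(size_rot i) er /= size_cat /= addnS.
Qed.

Lemma minimal_uniq : uniq p.
Proof.
apply: count_mem_uniq => x; case: (boolP (x \in p)) => xp; last by apply/count_memPn.
have [i s es] := rot_to xp.
have -> : count_mem x p = count_mem x (rot i p) by apply/permP; rewrite perm_sym perm_rot.
rewrite es /= eqxx; suff /count_memPn -> : x \notin s by [].
apply/negP => xs; case/splitPr: xs es => s1 s2 es.
have [h1 h2 h3 h4 sz] := minimal_rot es.
have c1 : cycle e (x :: s1) by rewrite /= rcons_path h1.
have c2 : cycle e (x :: s2) by rewrite /= rcons_path h3.
have := min c1; have := min c2; move: op; rewrite /= sz /=; lia.
Qed.

Lemma minimal_chordless i x s y : rot i p = x :: s -> y \in s -> e x y ->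
  y = head x s \/ y = last x s.
Proof.
move=> es ys xy; case/splitPr: ys es => s1 s2 es.
have [h1 h2 h3 h4 sz] := minimal_rot es; rewrite last_cat /=.
case: s1 es h1 h2 sz => [|a s1] es h1 h2 sz; first by left.
case: s2 es h3 h4 sz => [|b s2] es h3 h4 sz; first by right.
have yx : e y x by rewrite e_sym.
have c1 : cycle e (x :: rcons (a :: s1) y).
  by rewrite /cycle !rcons_path last_rcons yx h2 h1.
have c2 : cycle e (x :: y :: b :: s2).
  have h : path e y (rcons (b :: s2) x) by rewrite rcons_path h3.
  by move: h; rewrite /= xy.
have := min c1; have := min c2; move: op; rewrite /= size_rcons sz /=; lia.
Qed.

Lemma minimal_degree x : x \in p -> #|[set y in p | e x y]| = 2.
Proof.
move=> xp; have [i s es] := rot_to xp; have up := minimal_uniq.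
have us : uniq (x :: s) by rewrite -es rot_uniq.
have sz : size p = (size s).+1 by rewrite -(size_rot i) es.
case: s es us sz => [|a s] es us sz.
  by have := cp; rewrite -(rot_cycle i) es /= e_irr.
case/lastP: s es us sz => [|s b] es us sz; first by move: op; rewrite sz.
have mp y : y \in p = (y \in x :: a :: rcons s b) by rewrite -es mem_rot.
have := cp; rewrite -(rot_cycle i) es /= rcons_path last_rcons => /and3P[xa _ bx].
have ab : a != b.
  move: us => /= /and3P[_ h _]; apply: contraNneq h => ->.
  by rewrite mem_rcons inE eqxx.
rewrite -(_ : #|[set a; b]| = 2); last by rewrite cards2 ab.
congr #|pred_of_set _|; apply/setP => y; rewrite !inE; apply/andP/orP.
  case=> yp xy; have ys : y \in a :: rcons s b.
    move: yp; rewrite mp inE => /orP[/eqP yx|//]; by rewrite yx e_irr in xy.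
  by have := minimal_chordless es ys xy; rewrite /= last_rcons => -[->|->]; [left|right].
case=> /eqP->; rewrite mp !inE ?mem_rcons ?inE ?eqxx ?orbT ?xa //.
by rewrite e_sym bx.
Qed.

End Minimal.

Lemma minimal_odd_walk : (exists2 p, cycle e p & odd (size p)) ->
  exists p, [/\ cycle e p, odd (size p) &
    forall q, cycle e q -> odd (size q) -> size p <= size q].
Proof.
case=> p0 c0 o0; pose P n := `[< exists p, [/\ cycle e p, odd (size p) & size p = n] >].
have exP : exists n, P n by exists (size p0); apply/asboolP; exists p0.
case: (ex_minnP exP) => n /asboolP[p [cp op sp]] mn; exists p; split=> // q cq oq.
by rewrite sp; apply: mn; apply/asboolP; exists q.
Qed.

Lemma not_colorable_minimal :
  ~ (exists c : T -> bool, forall u v, e u v -> c u != c v) ->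
  exists p, [/\ cycle e p, odd (size p) &
    forall q, cycle e q -> odd (size q) -> size p <= size q].
Proof.
move=> nc; apply: minimal_odd_walk; apply: contrapT => no; apply: nc.
apply: odd_walk_free_coloring => p cp; apply/negP => op; apply: no; by exists p.
Qed.

End OddWalks.

Section Connectivity.

Lemma n_comp_le1 (T : finType) (e : rel T) : connect_sym e ->
  n_comp e predT <= 1 <-> forall x y, connect e x y.
Proof.
move=> cs; split=> [/card_le1_eqP h x y|h].
  rewrite -(root_connect cs); apply/eqP; by apply: h; apply/andP; split=> //;
    exact: (roots_root cs).
apply/card_le1_eqP => x y; rewrite !inE !andbT => /eqP <- /eqP <-.
by apply/(fingraph.rootP cs).
Qed.

Lemma n_comp_gt0 (T : finType) (e : rel T) (x : T) : connect_sym e -> 0 < n_comp e predT.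
Proof.
by move=> cs; apply/card_gt0P; exists (fingraph.root e x); apply/andP; split=> //;
  exact: (roots_root cs).
Qed.

Lemma n_comp_eq1 (T : finType) (e : rel T) : connect_sym e ->
  n_comp e predT = 1 <-> (exists x : T, true) /\ forall x y, connect e x y.
Proof.
move=> cs; rewrite -(n_comp_le1 cs); split=> [n1|[[x _] le]].
  by rewrite n1; split=> //; have /card_gt0P[x _] : 0 < n_comp e predT; [rewrite n1|exists x].
by apply/eqP; rewrite eqn_leq le n_comp_gt0.
Qed.

Lemma connect_embed (T1 T : finType) (e1 : rel T1) (e : rel T) (f : T1 -> T) :
  injective f -> (forall x y, e1 x y = e (f x) (f y)) ->
  (forall x b, e (f x) b -> exists y, f y = b) ->
  forall x y, connect e1 x y = connect e (f x) (f y).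
Proof.
move=> fI fe fim x y; apply/idP/idP => /connectP[p].
  elim: p x => [|z p IH] x /=; first by move=> _ ->; rewrite connect0.
  case/andP=> xz pz /(IH _ pz); apply: connect_trans; apply: connect1.
  by rewrite -fe.
elim: p x => [|b p IH] x /=; first by move=> _ /fI->; rewrite connect0.
case/andP=> xb; have [z zb] := fim _ _ xb; rewrite -zb in xb * => pz /(IH _ pz).
by apply: connect_trans; apply: connect1; rewrite fe.
Qed.

Lemma restr_sym (T : finType) (e : rel T) (X : {set T}) : symmetric e -> symmetric (restr e X).
Proof. by move=> es x y; rewrite /restr es [(x \in X) && _]andbC. Qed.

Lemma connected_on_sub (T : finType) (e e' : rel T) (X : {set T}) :
  {in X &, forall a b, e a b -> e' a b} -> connected_on e X -> connected_on e' X.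
Proof.
move=> h c a b aX bX; apply: connect_sub (c a b aX bX) => u v /and3P[uv uX vX].
by apply: connect1; rewrite /restr uX vX h.
Qed.

Lemma noncut_sub (T : finType) (e e' : rel T) (X : {set T}) :
  {in X &, forall a b, e a b -> e' a b} -> noncut e X -> noncut e' X.
Proof.
move=> h [c n]; split; first exact: connected_on_sub c.
move=> v vX; apply: connected_on_sub (n v vX) => a b.
by rewrite !in_setD1 => /andP[_ aX] /andP[_ bX]; exact: h.
Qed.

Variable G : sgraph.
Implicit Types (H B K : subgraph G) (X S : {set G}).

Lemma connected_no_cutP H : connected_no_cut H <->
  (exists v, v \in sub_vertices H) /\ noncut (@sub_adj G H) (sub_vertices H).
Proof.
set V := sub_vertices H; have ss := @sub_adj_sym G H.
have cs1 : connect_sym (@adj (graph_of_subgraph H)).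
  by apply: sym_connect_sym; exact: adj_sym.
have cs2 v : connect_sym (@adj (@del_vertex (graph_of_subgraph H) v)).
  by apply: sym_connect_sym; exact: adj_sym.
have emb1 (x y : graph_of_subgraph H) :
    connect (@adj _) x y = connect (restr (@sub_adj G H) V) (val x) (val y).
  apply: (@connect_embed _ _ _ _ (fun x : graph_of_subgraph H => val x)); first exact: val_inj.
    by move=> a b; rewrite /restr (valP a) (valP b) !andbT.
  by move=> a b /and3P[_ _ bV]; exists (Sub b bV); rewrite SubK.
have emb2 v (x y : @del_vertex (graph_of_subgraph H) v) :
    connect (@adj _) x y = connect (restr (@sub_adj G H) (V :\ val v)) (val (val x)) (val (val y)).
  apply: (@connect_embed _ _ _ _ (fun x : @del_vertex (graph_of_subgraph H) v => val (val x))).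
  - by move=> a b /val_inj/val_inj.
  - move=> a b; rewrite /restr !in_setD1 !(inj_eq val_inj) (valP a) (valP b).
    by rewrite (valP (val a)) (valP (val b)) !andbT.
  - move=> a b; rewrite /restr !in_setD1 => /and3P[_ _ /andP[bv bV]].
    have bv' : (Sub b bV : graph_of_subgraph H) != v by rewrite -(inj_eq val_inj) SubK.
    by exists (exist (fun u => u != v) _ bv').
rewrite /connected_no_cut /connected_graph /num_components (n_comp_eq1 cs1).
split=> [[[[x _] c] nc]|[[v vV] [c nc]]].
  split; first by exists (val x); exact: valP.
  split=> [a b aV bV|v vV a b].
    by have := c (Sub a aV) (Sub b bV); rewrite emb1 !SubK.
  rewrite !in_setD1 => /andP[av aV] /andP[bv bV].
  pose v' : graph_of_subgraph H := Sub v vV.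
  have n1 : n_comp (@adj (graph_of_subgraph H)) predT = 1.
    by apply/(n_comp_eq1 cs1); split=> //; exists x.
  have le : n_comp (@adj (del_vertex v')) predT <= 1.
    by rewrite leqNgt -n1; apply/negP; exact: nc v'.
  have av' : (Sub a aV : graph_of_subgraph H) != v' by rewrite -(inj_eq val_inj) !SubK.
  have bv' : (Sub b bV : graph_of_subgraph H) != v' by rewrite -(inj_eq val_inj) !SubK.
  have := (n_comp_le1 (cs2 v')).1 le
    (exist (fun u => u != v') _ av') (exist (fun u => u != v') _ bv').
  by rewrite emb2.
have all1 : forall x y : graph_of_subgraph H, connect (@adj _) x y.
  by move=> x y; rewrite emb1; apply: c; exact: valP.
split; first by split=> //; exists (Sub v vV).
move=> w; rewrite /cut_vertex /num_components.
have -> : n_comp (@adj (graph_of_subgraph H)) predT = 1.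
  by apply/(n_comp_eq1 cs1); split=> //; exists (Sub v vV).
apply/negP; rewrite -leqNgt; apply/(n_comp_le1 (cs2 w)) => x y; rewrite emb2.
apply: nc; first exact: valP.
  by rewrite in_setD1 (inj_eq val_inj) (valP x) (valP (val x)).
by rewrite in_setD1 (inj_eq val_inj) (valP y) (valP (val y)).
Qed.

Lemma restr_adj_vertices X u v : restr (@adj G) X u v -> u \in X.
Proof. by case/and3P. Qed.

Lemma restr_adj_adj X u v : restr (@adj G) X u v -> adj u v.
Proof. by case/and3P. Qed.

Definition induced X : subgraph G :=
  Subgraph (restr_sym X (@adj_sym G)) (@restr_adj_adj X) (@restr_adj_vertices X).

Lemma induced_noncut X : (exists v, v \in X) -> noncut adj X -> connected_no_cut (induced X).
Proof.
move=> ex nc; apply/connected_no_cutP; split=> //.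
by apply: noncut_sub nc => a b aX bX ab; rewrite /= /restr ab aX bX.
Qed.

Lemma noncut_vertices H : connected_no_cut H -> noncut adj (sub_vertices H).
Proof.
move/connected_no_cutP => [_ nc]; apply: noncut_sub nc => a b _ _; exact: sub_adj_adj.
Qed.

Lemma le_induced H : subgraph_le H (induced (sub_vertices H)).
Proof.
split=> // u v uv; rewrite /= /restr (sub_adj_adj uv) (sub_adj_vertices uv).
by move: uv; rewrite sub_adj_sym => /sub_adj_vertices.
Qed.

Lemma block_induced B u v : block B -> u \in sub_vertices B -> v \in sub_vertices B ->
  sub_adj B u v = adj u v.
Proof.
move=> [cB mB] uB vB; apply/idP/idP => [|uv]; first exact: sub_adj_adj.
have [|_] := mB _ _ (le_induced B); last by apply; rewrite /= /restr uv uB vB.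
apply: induced_noncut; last exact: noncut_vertices.
by exists u.
Qed.

Lemma block_containing X : (exists v, v \in X) -> noncut adj X ->
  exists2 B, block B & X \subset sub_vertices B.
Proof.
move=> exX ncX; pose P (Y : {set G}) := `[< (exists v, v \in Y) /\ noncut adj Y >].
have PX : P X by apply/asboolP.
have [Y /maxsetP[/asboolP[exY ncY] mY] XY] := maxset_exists PX.
exists (induced Y) => //; split; first exact: induced_noncut.
move=> K cK [YK eK]; have KY : sub_vertices K = Y.
  apply: mY => //; apply/asboolP; split; last exact: noncut_vertices.
  by have [v vY] := exY; exists v; exact: (subsetP YK).
have [h1 h2] := le_induced K; split; first by rewrite /= KY.
by move=> u v /h2; rewrite /= KY.
Qed.

End Connectivity.

Section Ears.
Variable G : sgraph.
Implicit Types (u v w x y z a b c d : G) (p q t : seq G) (A S : {set G}).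

Lemma connect_exit (e : rel G) x y A : connect e x y -> x \in A -> y \notin A ->
  exists u v, [/\ e u v, u \in A & v \notin A].
Proof.
case/connectP => p; elim: p x => [|z p IH] x /=; first by move=> _ -> ->.
case/andP=> xz pz ly xA yA; case: (boolP (z \in A)) => zA; first exact: IH pz ly zA yA.
by exists x, z.
Qed.

Lemma first_hit A p : has (mem A) p ->
  exists p1 b p2, [/\ p = p1 ++ b :: p2, b \in A & all [predC A] p1].
Proof.
elim: p => //= x p IH; case: (boolP (x \in A)) => xA /=.
  by exists [::], x, p.
by case/IH => p1 [b [p2 [-> bA aA]]]; exists (x :: p1), b, p2; rewrite /= xA.
Qed.

Lemma ear S A s : noncut adj S -> A \subset S -> 1 < #|A| -> s \in S -> s \notin A ->
  exists a b d q, [/\ a \in A, b \in A & a != b] /\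
    [/\ path adj a (rcons (d :: q) b), uniq (d :: q) & {subset d :: q <= S :\: A}].
Proof.
move=> [cS nS] AS A1 sS sA; have [a0 a0A] : exists a, a \in A by apply/card_gt0P/ltnW.
have [a [d [/and3P[ad aS dS] aA dA]]] := connect_exit (cS _ _ (subsetP AS _ a0A) sS) a0A sA.
have [a' a'A a'a] : exists2 a', a' \in A & a' != a.
  have /card_gt0P[a'] : 0 < #|A :\ a| by move: A1; rewrite (cardsD1 a A) aA.
  by rewrite in_setD1 => /andP[n1 n2]; exists a'.
have da : d != a by apply: contraNneq dA => ->.
have : connect (restr adj (S :\ a)) d a'.
  by apply: (nS a aS); rewrite in_setD1 ?da ?dS // a'a (subsetP AS).
case/connectP => p0 pp0 lp0; have := lp0; case/shortenP: pp0 => p pp up _ lp.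
have hA : has (mem A) p.
  apply/hasP; exists a' => //; rewrite lp; case: (p) lp => [|y r] /= e1; last exact: mem_last.
  by move: dA; rewrite -e1 a'A.
have [p1 [b [p2 [ep bA aA1]]]] := first_hit hA.
have pS : all (mem (S :\ a)) p.
  elim: (p) d pp {dA da dS ad up lp lp0 ep hA} => //= y r IH d /andP[/and3P[_ _ yS] pr].
  by rewrite yS (IH y).
move: pS; rewrite ep all_cat /= => /and3P[/allP p1S bS _].
exists a, b, d, p1; split; split=> //.
- by move: bS; rewrite /= in_setD1 eq_sym => /andP[].
- rewrite /= ad /=; have : path adj d p.
    by apply: sub_path pp => u v /and3P[].
  by rewrite ep -cat_rcons cat_path => /andP[].
- by move: up; rewrite ep -cat_cons cat_uniq => /andP[].
move=> v; rewrite inE in_setD => /orP[/eqP->|vp1]; first by rewrite dA dS.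
have := p1S _ vp1; rewrite /= in_setD1 => /andP[_ ->]; rewrite andbT.
exact: (allP aA1).
Qed.

Hypothesis deg3 : forall v, deg v <= 3.
Hypothesis odd_count : forall p, uniq p -> cycle adj p -> odd (size p) ->
  #|within [set v in p]|.+1 = 4 * (size p)./2.

Definition ldeg p v := #|[set u in p | adj v u]|.

Lemma ldeg_le3 p v : ldeg p v <= 3.
Proof.
apply: leq_trans (deg3 v); apply: subset_leq_card; apply/subsetP => u.
by rewrite !inE => /andP[].
Qed.

Lemma ldeg_outside p v w : w \notin p -> adj v w -> ldeg p v <= 2.
Proof.
move=> wp vw; rewrite -ltnS; apply: leq_trans (deg3 v); apply: proper_card.
apply/properP; split; first by apply/subsetP => u; rewrite !inE => /andP[].
by exists w; rewrite !inE ?vw // negb_and wp.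
Qed.

Lemma ldeg_pair p v a b : (forall u, u \in p -> adj v u -> u = a \/ u = b) -> ldeg p v <= 2.
Proof.
move=> h; apply: (@leq_trans #|[set a; b]|); last by rewrite cards2; case: (a != b).
apply: subset_leq_card; apply/subsetP => u; rewrite !inE => /andP[up vu].
by have [->|->] := h u up vu; rewrite eqxx ?orbT.
Qed.

(** [odd_count] says that the sum of [4 - ldeg p v] over the cycle is 6. *)
Lemma odd_cycle_size p : uniq p -> cycle adj p -> odd (size p) ->
  size p = 3 \/ size p = 5 /\
    forall x y, x \in p -> y \in p -> x != y -> ldeg p x <= 2 -> ldeg p y <= 2 -> False.
Proof.
move=> up cp op; have cnt := odd_count up cp op.
have := handshake [set v in p]; rewrite (eq_bigr (ldeg p)); last first.
  by move=> v _; apply: eq_card => u; rewrite !inE.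
move=> hs; have cs : #|[set v in p]| = size p by rewrite cardsE; exact/card_uniqP.
have n1 : size p != 1.
  by apply/eqP; case: (p) cp => [|a [|b q]] //=; rewrite adj_irrefl.
have le : \sum_(v in [set v in p]) ldeg p v <= 3 * size p.
  rewrite -cs mulnC -sum_nat_const; apply: leq_sum => v _; exact: ldeg_le3.
have [s3|s5] : size p = 3 \/ size p = 5.
  by move: op n1 le hs cnt; move: (size p) (\sum_(v in _) _) #|within _| => n s m; lia.
  by left.
right; split=> // x y xp yp xy dx dy.
have xS : x \in [set v in p] by rewrite inE.
have yS : (y \in [set v in p]) && (y != x) by rewrite inE yp eq_sym.
move: hs; rewrite (bigD1 x) //= (bigD1 y) //=.
have : \sum_(i | (i \in [set v in p]) && (i != x) && (i != y)) ldeg p i <= 3 * 3.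
  apply: (@leq_trans (\sum_(i | (i \in [set v in p]) && (i != x) && (i != y)) 3)).
    by apply: leq_sum => v _; exact: ldeg_le3.
  rewrite sum_nat_const leq_mul2r /=.
  have : #|[set v in p] :\ x :\ y| = 3.
    have := cardsD1 x [set v in p]; have := cardsD1 y ([set v in p] :\ x).
    by rewrite in_setD1 eq_sym xy !inE xp yp /= cs s5; lia.
  move=> <-; apply: eq_leq; apply: eq_card => v; rewrite !inE.
  by rewrite unfold_in /= !inE; case: (v == x); case: (v == y); rewrite ?andbF ?andbT.
rewrite s5 in cnt; move: cnt => /=; lia.
Qed.

Lemma odd_cycle_outside p x y w w' : uniq p -> cycle adj p -> odd (size p) ->
  x \in p -> y \in p -> x != y -> w \notin p -> w' \notin p -> adj x w -> adj y w' ->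
  size p = 3.
Proof.
move=> up cp op xp yp xy wp w'p xw yw.
case: (odd_cycle_size up cp op) => // -[_ h].
by case: (h x y xp yp xy); [exact: ldeg_outside xw|exact: ldeg_outside yw].
Qed.

Lemma saturated v a b c : adj v a -> adj v b -> adj v c -> uniq [:: a; b; c] ->
  forall w, adj v w -> w \in [:: a; b; c].
Proof.
move=> va vb vc u3 w vw; have : [set u in [:: a; b; c]] = [set u | adj v u].
  apply/eqP; rewrite eqEcard; apply/andP; split.
    by apply/subsetP => u; rewrite !inE => /or3P[]/eqP->.
  by rewrite [leqRHS](_ : _ = 3) ?(deg3 v) // cardsE (card_uniqP u3).
by move/setP/(_ w); rewrite !inE vw => ->.
Qed.

Definition K4_on S a b c u :=
  S =i [:: a; b; c; u] /\ [/\ adj a b, adj a c, adj b c & [/\ adj a u, adj b u & adj c u]].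

Definition K112_on S a b c u :=
  [/\ S =i [:: a; b; c; u], c != u & [/\ adj a b, adj a c & adj b c] /\
    [/\ adj a u, adj b u & ~~ adj c u]].

Definition C5'_on S a b c u w :=
  [/\ S =i [:: a; b; c; u; w], uniq [:: a; b; c; u; w], [/\ adj a b, adj a c & adj b c],
    [/\ adj a u, adj b u & ~~ adj c u] &
    [/\ adj c w, adj u w, ~~ adj a w & ~~ adj b w]].

Lemma extend_K112 S a b c u d q : noncut adj S -> {subset [:: a; b; c; u] <= S} ->
  uniq [:: a; b; c; u] ->
  adj a b -> adj a c -> adj b c -> adj a u -> adj b u -> ~~ adj c u ->
  path adj c (rcons (d :: q) u) -> uniq (d :: q) -> {subset d :: q <= S :\: [set v in [:: a; b;
    c; u]]} ->
  exists w, C5'_on S a b c u w.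
Proof.
move=> nS sS u4 ab ac bc au bu cu pq uq qS.
have [ba ca cb ua ub] : [/\ adj b a, adj c a, adj c b, adj u a & adj u b].
  by rewrite !(adj_sym b a) !(adj_sym c) !(adj_sym u).
have qn v : v \in [:: a; b; c; u] -> v \notin d :: q.
  by move=> v4; apply/negP => /qS; rewrite in_setD inE v4.
have bq := qn b; have cq := qn c; have aq := qn a; have uq' := qn u.
rewrite !inE !eqxx ?orbT in bq cq aq uq'.
have {}bq := bq isT; have {}cq := cq isT; have {}aq := aq isT; have {}uq' := uq' isT.
move: (u4); rewrite /= !inE !negb_or => /and4P[/and3P[nab nac nau] /andP[nbc nbu] ncu _].
have cyc r : path adj u (rcons r c) -> cycle adj (c :: (d :: q) ++ u :: r).
  move=> h; rewrite /cycle rcons_cat rcons_cons -cat_rcons cat_path.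
  by rewrite pq last_rcons h.
case: (boolP (odd (size q))) => oq.
  have : size (c :: (d :: q) ++ [:: u; a]) = 3.
    apply: (@odd_cycle_outside _ c u b b); rewrite ?inE ?mem_cat ?inE ?eqxx ?orbT //.
    - rewrite cons_uniq cat_uniq uq mem_cat /= !inE; move: cq aq uq'; rewrite !negb_or.
      move=> /andP[-> ->] /andP[-> ->] /andP[-> ->].
      by rewrite ncu (eq_sym c a) nac (eq_sym u a) nau.
    - by apply: cyc; rewrite /= ua ac.
    - by rewrite /= size_cat /= addn2 /= oq.
    - by move: bq; rewrite ?inE !negb_or => /andP[-> ->]; rewrite nbc nbu eq_sym nab.
    - by move: bq; rewrite ?inE !negb_or => /andP[-> ->]; rewrite nbc nbu eq_sym nab.
  by rewrite /= size_cat /= addn2.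
have u' : uniq (c :: (d :: q) ++ [:: u; a; b]).
  rewrite cons_uniq cat_uniq uq mem_cat /= !inE; move: cq aq bq uq'.
  rewrite !negb_or => /andP[-> ->] /andP[-> ->] /andP[-> ->] /andP[-> ->].
  by rewrite ncu (eq_sym c a) nac (eq_sym u a) nau (eq_sym c b) nbc (eq_sym u b) nbu nab.
have : size (c :: (d :: q) ++ [:: u; a; b]) = 5.
  have [|||[-> //]] := odd_cycle_size u'.
  - by apply: cyc; rewrite /= ua ab bc.
  - by rewrite /= size_cat /= addn3 /= negbK negbK.
  - by rewrite /= size_cat /= addn3.
rewrite /= size_cat /= addn3 => -[/size0nil q0]; subst q; exists d.
move: pq => /= /and3P[cd du _]; have ud : adj u d by rewrite adj_sym.
move: aq bq cq uq'; rewrite !negb_or => /andP[nad _] /andP[nbd _] /andP[ncd _] /andP[nud _].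
have sata := saturated ab ac au; have satb := saturated ba bc bu.
have satc := saturated ca cb cd; have satu := saturated ua ub ud.
rewrite /= !inE !negb_or nbc nbu ncu in sata; have {}sata := sata isT.
rewrite /= !inE !negb_or nac nau ncu in satb; have {}satb := satb isT.
rewrite /= !inE !negb_or nab nad nbd in satc satu.
have {}satc := satc isT; have {}satu := satu isT.
have nadd : ~~ adj a d.
  by apply/negP => /sata; rewrite !inE ![d == _]eq_sym (negbTE nbd) (negbTE ncd) (negbTE nud).
have nbdd : ~~ adj b d.
  by apply/negP => /satb; rewrite !inE ![d == _]eq_sym (negbTE nad) (negbTE ncd) (negbTE nud).
have u5 : uniq [:: a; b; c; u; d].
  by rewrite /= !inE !negb_or nab nac nau nad nbc nbu nbd ncu ncd nud.
split=> //; move=> v; apply/idP/idP => [vS|]; last first.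
  rewrite -[[:: _; _; _; _; _]]/([:: a; b; c; u] ++ [:: d]) mem_cat => /orP[/sS//|].
  by rewrite inE => /eqP->; have /qS : d \in [:: d]; [rewrite inE|rewrite in_setD => /andP[]].
apply/negPn/negP => vn.
have [||||e1 [e2 [f [r [[e1A e2A e12] [pr ur rS]]]]]] := @ear S [set v in [:: a; b; c; u; d]] v nS.
- apply/subsetP => t; rewrite inE -[[:: _; _; _; _; _]]/([:: a; b; c;
    u] ++ [:: d]) mem_cat => /orP[/sS//|].
  by rewrite inE => /eqP->; have /qS : d \in [:: d]; [rewrite inE|rewrite in_setD => /andP[]].
- by rewrite cardsE (card_uniqP u5).
- done.
- by rewrite inE.
have only (e t : G) : e \in [set v in [:: a; b; c; u; d]] -> adj e t ->
    t \notin [:: a; b; c; u; d] -> e = d.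
  rewrite inE !inE => /or4P[/eqP->|/eqP->|/eqP->|/orP[]/eqP->] //.
  - by move/sata; rewrite !inE => /or3P[]->; rewrite ?orbT.
  - by move/satb; rewrite !inE => /or3P[]->; rewrite ?orbT.
  - by move/satc; rewrite !inE => /or3P[]->; rewrite ?orbT.
  - by move/satu; rewrite !inE => /or3P[]->; rewrite ?orbT.
move: pr; rewrite /= rcons_path => /and3P[e1f _ le2].
have out (t : G) : t \in f :: r -> t \notin [:: a; b; c; u; d].
  by move/rS; rewrite in_setD inE => /andP[].
have h1 := only _ _ e1A e1f (out f (mem_head _ _)).
have h2 := only e2 (last f r) e2A; rewrite adj_sym in h2.
by case/eqP: e12; rewrite h1 (h2 le2 (out _ (mem_last _ _))).
Qed.

(** The triangle [a b c] and the vertex [u] share the edge [a b]; as [a] and [b] then have degree 3,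
    an ear can only join [c] to [u]. *)
Lemma classify_common S a b c u : noncut adj S -> {subset [:: a; b; c; u] <= S} ->
  uniq [:: a; b; c; u] -> adj a b -> adj a c -> adj b c -> adj a u -> adj b u ->
  [\/ K4_on S a b c u, K112_on S a b c u |
     exists a b c u w, C5'_on S a b c u w].
Proof.
move=> nS sS u4 ab ac bc au bu.
move: (u4); rewrite /= !inE !negb_or => /and4P[/and3P[nab nac nau] /andP[nbc nbu] ncu _].
have [ba ca cb ua ub] : [/\ adj b a, adj c a, adj c b, adj u a & adj u b].
  by rewrite !(adj_sym b a) !(adj_sym c) !(adj_sym u).
pose A := [set v in [:: a; b; c; u]].
have AS : A \subset S by apply/subsetP => v; rewrite inE; exact: sS.
have A1 : 1 < #|A| by rewrite cardsE (card_uniqP u4).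
have sata := saturated ab ac au; have satb := saturated ba bc bu.
rewrite /= !inE !negb_or nbc nbu ncu in sata; have {}sata := sata isT.
rewrite /= !inE !negb_or nac nau ncu in satb; have {}satb := satb isT.
have sub1 (t v : G) : v \in A -> adj v t -> t \notin A -> v = c \/ v = u.
  rewrite !inE => /or4P[]/eqP->; try by [left|right].
  - by move/sata; rewrite !inE => /or3P[]->; rewrite ?orbT.
  - by move/satb; rewrite !inE => /or3P[]->; rewrite ?orbT.
have [full|] := EM (forall v, v \in S -> v \in A).
  have SA : S =i [:: a; b; c; u].
    by move=> v; apply/idP/idP => [/full|/sS//]; rewrite inE.
  case: (boolP (adj c u)) => cu; first by constructor 1.
  by constructor 2.
move=> /existsNP[s /not_implyP[sS' /negP sA]].
have [e1 [e2 [d [q [[e1A e2A e12] [pq uq qS]]]]]] := ear nS AS A1 sS' sA.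
have out (t : G) : t \in d :: q -> t \notin A by move/qS; rewrite in_setD => /andP[].
have [e1d le2] : adj e1 d /\ adj e2 (last d q).
  by move: pq; rewrite /= rcons_path adj_sym => /and3P[? _]; rewrite adj_sym.
have c1 := sub1 _ _ e1A e1d (out _ (mem_head _ _)).
have c2 := sub1 _ _ e2A le2 (out _ (mem_last _ _)).
have ncu' : ~~ adj c u.
  apply/negP => cu; have uc : adj u c by rewrite adj_sym.
  have satc := saturated ca cb cu; have satu := saturated ua ub uc.
  rewrite /= !inE !negb_or nab nau nbu in satc; have {}satc := satc isT.
  rewrite /= !inE !negb_or nab nac nbc in satu; have {}satu := satu isT.
  have := out _ (mem_head d q); rewrite !inE !negb_or => /and4P[h1 h2 h3 h4].
  case: c1 => ee; move: e1d; rewrite ee.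
    by move/satc; rewrite !inE (negbTE h1) (negbTE h2) (negbTE h4).
  by move/satu; rewrite !inE (negbTE h1) (negbTE h2) (negbTE h3).
constructor 3; case: c1 c2 => [E1|E1] [E2|E2]; rewrite E1 E2 ?eqxx // in e12 pq.
  have [w h] := extend_K112 nS sS u4 ab ac bc au bu ncu' pq uq qS.
  by exists a, b, c, u, w.
have pm v : (v \in [:: a; b; u; c]) = (v \in [:: a; b; c; u]).
  by rewrite !inE [(v == u) || _]orbC.
have sS2 : {subset [:: a; b; u; c] <= S} by move=> v; rewrite pm; exact: sS.
have u42 : uniq [:: a; b; u; c].
  by rewrite /= !inE !negb_or nab nac nau nbc nbu eq_sym ncu.
have nuc : ~~ adj u c by rewrite adj_sym.
have qS2 : {subset d :: q <= S :\: [set v in [:: a; b; u; c]]}.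
  by move=> v /qS; rewrite !in_setD !inE [(v == u) || _]orbC.
have [w h] := extend_K112 nS sS2 u42 ab au bu ac bc nuc pq uq qS2.
by exists a, b, u, c, w.
Qed.

Lemma triangle_third x y z a b : adj x y -> adj x z -> adj y z ->
  a \in [set v in [:: x; y; z]] -> b \in [set v in [:: x; y; z]] -> a != b ->
  exists c, [/\ adj a b, adj a c, adj b c & [set v in [:: a; b; c]] = [set v in [:: x; y; z]]].
Proof.
move=> xy xz yz; have [yx zx zy] : [/\ adj y x, adj z x & adj z y].
  by rewrite !(adj_sym z) (adj_sym y).
rewrite !inE => /or3P[]/eqP-> /or3P[]/eqP->; rewrite ?eqxx // => _;
  [exists z|exists y|exists z|exists x|exists y|exists x]; split=> //;
  by apply/setP => v; rewrite !inE; case: (v == x); case: (v == y); case: (v == z).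
Qed.

Lemma classify_triangle S x y z : noncut adj S -> {subset [:: x; y; z] <= S} ->
  adj x y -> adj x z -> adj y z ->
  S =i [:: x; y; z] \/ exists a b c u, [\/ K4_on S a b c u, K112_on S a b c u |
     exists w, C5'_on S a b c u w].
Proof.
move=> nS sS xy xz yz; pose T := [set v in [:: x; y; z]].
have TS : T \subset S by apply/subsetP => v; rewrite inE; exact: sS.
have [full|] := EM (forall v, v \in S -> v \in T).
  by left=> v; apply/idP/idP => [/full|/sS//]; rewrite inE.
move=> /existsNP[s /not_implyP[sS' /negP sT]]; right.
have [[u [a [b [uS uT [aT bT ab] [au bu]]]]]|nocom] := EM (exists u a b,
  [/\ u \in S, u \notin T, [/\ a \in T, b \in T & a != b] & adj a u /\ adj b u]).
  have [c [adab adac adbc eT]] := triangle_third xy xz yz aT bT ab.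
  have u4 : uniq [:: a; b; c; u].
    move: uT; rewrite -/T in eT; rewrite -eT !inE !negb_or ![u == _]eq_sym => /and3P[h1 h2 h3].
    by rewrite /= !inE !negb_or ab (adj_neq adac) h1 h2 h3 (adj_neq adbc).
  have sS4 : {subset [:: a; b; c; u] <= S}.
    move=> v; rewrite -[[:: _; _; _; _]]/([:: a; b; c] ++ [:: u]) mem_cat => /orP[h|].
      by apply: (subsetP TS); rewrite /T -eT inE.
    by rewrite inE => /eqP->.
  have [h|h|[a' [b' [c' [u' [w h]]]]]] := classify_common nS sS4 u4 adab adac adbc au bu.
  - by exists a, b, c, u; constructor 1.
  - by exists a, b, c, u; constructor 2.
  - by exists a', b', c', u'; constructor 3; exists w.
have T1 : 1 < #|T|.
  have -> : T = [set x; y; z] by apply/setP => v; rewrite !inE orbA.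
  by have [_ ->] := triangle_critical xy yz xz.
have [a [b [d [q [[aT bT ab] [pq uq qS]]]]]] := ear nS TS T1 sS' sT.
have [c [adab adac adbc eT]] := triangle_third xy xz yz aT bT ab.
have [adba adca adcb] : [/\ adj b a, adj c a & adj c b].
  by rewrite !(adj_sym c) (adj_sym b).
have cT : c \in T by rewrite /T -eT !inE eqxx !orbT.
have nac := adj_neq adac; have nbc := adj_neq adbc.
have qn v : v \in T -> v \notin d :: q by move=> vT; apply/negP => /qS; rewrite in_setD vT.
have aq := qn a aT; have bq := qn b bT; have cq := qn c cT.
have cyc r : path adj b (rcons r a) -> cycle adj (a :: (d :: q) ++ b :: r).
  move=> h; rewrite /cycle rcons_cat rcons_cons -cat_rcons cat_path.
  by rewrite pq last_rcons h.
have [ad lb] : adj a d /\ adj b (last d q).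
  by move: pq; rewrite /= rcons_path => /and3P[-> _]; rewrite adj_sym.
have nocom' u v w : u \in d :: q -> v \in T -> w \in T -> v != w -> adj u v -> adj u w -> False.
  move=> uq' vT wT vw uv uw; apply: nocom; exists u, v, w.
  have := qS _ uq'; rewrite in_setD => /andP[uT uS]; split=> //.
  by rewrite !(adj_sym _ u).
case: (boolP (odd (size q))) => oq; last first.
  have : size (a :: (d :: q) ++ [:: b]) = 3.
    apply: (@odd_cycle_outside _ a b c c); rewrite ?inE ?mem_cat ?inE ?eqxx ?orbT //.
    - rewrite cons_uniq cat_uniq uq mem_cat; move: aq bq; rewrite !inE !negb_or.
      by move=> /andP[-> ->] /andP[-> ->]; rewrite ab.
    - by apply: cyc; rewrite /= adba.
    - by rewrite /= size_cat /= addn1 /= negbK.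
    - by move: cq; rewrite ?inE !negb_or => /andP[-> ->]; rewrite (eq_sym c a) nac (eq_sym c b) nbc.
    - by move: cq; rewrite ?inE !negb_or => /andP[-> ->]; rewrite (eq_sym c a) nac (eq_sym c b) nbc.
  rewrite /= size_cat /= addn1 => -[/size0nil q0]; subst q.
  case: (nocom' d a b _ aT bT ab) => //; first by rewrite inE.
    by rewrite adj_sym.
  by rewrite adj_sym.
have u5 : uniq (a :: (d :: q) ++ [:: b; c]).
  rewrite cons_uniq cat_uniq uq mem_cat /= !inE; move: aq bq cq; rewrite !inE !negb_or.
  by move=> /andP[-> ->] /andP[-> ->] /andP[-> ->]; rewrite ab nac nbc.
have c5 : cycle adj (a :: (d :: q) ++ [:: b; c]) by apply: cyc; rewrite /= adbc adca.
have o5 : odd (size (a :: (d :: q) ++ [:: b; c])) by rewrite /= size_cat /= addn2 /= oq.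
case: (odd_cycle_size u5 c5 o5) => [|[]].
  by rewrite /= size_cat /= addn2.
rewrite /= size_cat /= addn2 => -[]; case: q pq uq qS aq bq cq lb nocom' oq u5 c5 o5 {qn cyc} =>
  [|d' [|? ?]] //=.
move=> pq uq qS aq bq cq lb nocom' _ u5 c5 o5 _ bad; case: (bad d d').
- by rewrite !inE eqxx orbT.
- by rewrite !inE eqxx !orbT.
- by move: uq; rewrite inE => /andP[].
- apply: (@ldeg_pair _ _ a d') => v; rewrite !inE => /or4P[/eqP->|/eqP->|/eqP->|/orP[]/eqP->].
  + by left.
  + by rewrite adj_irrefl.
  + by right.
  + move=> db; case: (nocom' d a b) => //; rewrite ?inE ?eqxx //; by rewrite adj_sym.
  + move=> dc; case: (nocom' d a c) => //; rewrite ?inE ?eqxx //; by rewrite adj_sym.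
- apply: (@ldeg_pair _ _ b d) => v; rewrite !inE => /or4P[/eqP->|/eqP->|/eqP->|/orP[]/eqP->].
  + move=> da; case: (nocom' d' a b) => //; rewrite ?inE ?eqxx ?orbT //; by rewrite adj_sym.
  + by right.
  + by rewrite adj_irrefl.
  + by left.
  + move=> dc; case: (nocom' d' b c) => //; rewrite ?inE ?eqxx ?orbT //; by rewrite adj_sym.
Qed.

End Ears.

(** * The theorem *)

Section Isomorphisms.

Lemma graph_iso_sym (G H : sgraph) : graph_iso G H -> graph_iso H G.
Proof.
case=> f [[g fK gK] fadj]; exists g; split; first by exists f.
by move=> u v; rewrite -fadj !gK.
Qed.

Lemma deg_iso (G H : sgraph) (f : G -> H) u : bijective f ->
  (forall u v, adj (f u) (f v) = adj u v) -> deg (f u) = deg u.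
Proof.
move=> [g fK gK] fadj; rewrite /deg -(card_imset _ (can_inj fK)); apply: eq_card => v.
rewrite inE; apply/idP/imsetP => [uv|[w]]; last by rewrite inE -fadj => uw ->.
by exists (g v); rewrite ?gK // inE -fadj gK.
Qed.

Lemma sum_deg_iso (G H : sgraph) : graph_iso G H -> \sum_(u : G) deg u = \sum_(v : H) deg v.
Proof.
case=> f [bf fadj]; rewrite [RHS](reindex f) /=; last exact: onW_bij.
by apply: eq_bigr => u _; rewrite (deg_iso u bf fadj).
Qed.

Lemma card_iso (G H : sgraph) : graph_iso G H -> #|G| = #|H|.
Proof. by case=> f [bf _]; exact: bij_eq_card bf. Qed.

Variable G : sgraph.

Lemma card_subgraph (B : subgraph G) : #|graph_of_subgraph B| = #|sub_vertices B|.
Proof. exact: card_sig. Qed.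

Lemma subgraph_iso (B : subgraph G) (K : sgraph) (g : K -> G) : block B ->
  injective g -> (forall i, g i \in sub_vertices B) -> #|sub_vertices B| <= #|K| ->
  (forall i j, adj (g i) (g j) = adj i j) -> graph_iso (graph_of_subgraph B) K.
Proof.
move=> bB gI gB cK gadj; apply: graph_iso_sym.
pose h i : graph_of_subgraph B := Sub (g i) (gB i).
have hI : injective h by move=> i j /(congr1 val); rewrite !SubK => /gI.
exists h; split; last first.
  by move=> i j; rewrite -gadj -(block_induced bB (gB i) (gB j)).
by apply: inj_card_bij => //; rewrite card_subgraph.
Qed.

Lemma clique_iso (B : subgraph G) (t : seq G) (v0 : G) : block B -> uniq t ->
  sub_vertices B =i t -> {in t &, forall u v, u != v -> adj u v} ->
  graph_iso (graph_of_subgraph B) (complete_graph (size t)).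
Proof.
move=> bB ut Bt cl.
have lt (i : 'I_(size t)) : nth v0 t i \in t by rewrite mem_nth.
apply: (@subgraph_iso B (complete_graph (size t)) (fun i => nth v0 t i)) => //.
- by move=> i j /eqP; rewrite nth_uniq // => /eqP; exact: val_inj.
- by move=> i; rewrite Bt lt.
- rewrite card_ord (eq_card Bt); exact: card_size.
move=> i j; rewrite /= /complete_adj; case: (eqVneq i j) => [->|ij]; first exact: adj_irrefl.
by apply: cl => //; rewrite nth_uniq.
Qed.

Lemma K112_iso (B : subgraph G) (a b c u : G) : block B -> K112_on (sub_vertices B) a b c u ->
  graph_iso (graph_of_subgraph B) (complete_multipartite [:: 1; 1; 2]).
Proof.
move=> bB [SB ncu [[ab ac bc] [au bu cu]]].
have [ba ca cb ua ub] : [/\ adj b a, adj c a, adj c b, adj u a & adj u b].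
  by rewrite !(adj_sym b a) !(adj_sym c) !(adj_sym u).
have uc : adj u c = false by rewrite adj_sym (negbTE cu).
pose g (i : complete_multipartite [:: 1; 1; 2]) : G :=
  nth a [:: a; b; nth c [:: c; u] (tagged i)] (tag i).
have nab := adj_neq ab; have nac := adj_neq ac; have nbc := adj_neq bc.
have nau := adj_neq au; have nbu := adj_neq bu.
have cases (P : complete_multipartite [:: 1; 1; 2] -> Prop) :
  P (existT _ (@Ordinal 3 0 isT) (@Ordinal 1 0 isT)) ->
  P (existT _ (@Ordinal 3 1 isT) (@Ordinal 1 0 isT)) ->
  P (existT _ (@Ordinal 3 2 isT) (@Ordinal 2 0 isT)) ->
  P (existT _ (@Ordinal 3 2 isT) (@Ordinal 2 1 isT)) -> forall i, P i.
  move=> h1 h2 h3 h4 [[[|[|[|k]]] hk] [[|[|j]] hj]] //;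
    move: hk hj => hk; have -> : hk = isT by exact: eq_irrelevance.
  - by move=> hj; have -> : hj = isT by exact: eq_irrelevance.
  - by move=> hj; have -> : hj = isT by exact: eq_irrelevance.
  - by move=> hj; have -> : hj = isT by exact: eq_irrelevance.
  - by move=> hj; have -> : hj = isT by exact: eq_irrelevance.
apply: (@subgraph_iso B _ g) => //.
- elim/cases; elim/cases => //= /eqP;
    rewrite /g /= ?(negbTE nab) ?(negbTE nac) ?(negbTE nbc) ?(negbTE nau) ?(negbTE nbu)
      ?(negbTE ncu) // eq_sym ?(negbTE nab) ?(negbTE nac) ?(negbTE nbc) ?(negbTE nau)
      ?(negbTE nbu) ?(negbTE ncu) //.
- by elim/cases; rewrite SB /g /= !inE eqxx ?orbT.
- rewrite (eq_card SB); apply: (leq_trans (card_size _)).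
  by rewrite card_tagged sumnE big_map big_enum !big_ord_recl big_ord0 /= !card_ord.
by elim/cases; elim/cases; rewrite /g /= /multipartite_adj /= ?adj_irrefl ?ab ?ac ?bc ?au ?bu
  ?ba ?ca ?cb ?ua ?ub ?uc ?(negbTE cu).
Qed.

Lemma eq_set2 (T : finType) (a b c d : T) :
  ([set a; b] == [set c; d])%SET = (((a == c) && (b == d)) || ((a == d) && (b == c))).
Proof.
apply/eqP/idP => [e|/orP[]/andP[/eqP-> /eqP->]] //; last by rewrite setUC.
have ha : a \in [set c; d] by rewrite -e !inE eqxx.
have hb : b \in [set c; d] by rewrite -e !inE eqxx orbT.
have hc : c \in [set a; b] by rewrite e !inE eqxx.
have hd : d \in [set a; b] by rewrite e !inE eqxx orbT.
move: ha hb hc hd; rewrite !inE ![c == _]eq_sym ![d == _]eq_sym.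
by case: (a == c); case: (a == d); case: (b == c); case: (b == d).
Qed.

Lemma Z5_cases (P : 'Z_5 -> Prop) :
  P (@Ordinal 5 0 isT) -> P (@Ordinal 5 1 isT) -> P (@Ordinal 5 2 isT) ->
  P (@Ordinal 5 3 isT) -> P (@Ordinal 5 4 isT) -> forall i, P i.
Proof.
move=> h0 h1 h2 h3 h4 [[|[|[|[|[|k]]]]] hk] //;
  by rewrite (eq_irrelevance hk isT).
Qed.

Lemma C5'_iso (B : subgraph G) (a b c u w : G) : block B -> C5'_on (sub_vertices B) a b c u w ->
  graph_iso (graph_of_subgraph B) cycle5'.
Proof.
move=> bB [SB u5 [ab ac bc] [au bu cu] [cw uw aw bw]].
have [ba ca cb ua ub] : [/\ adj b a, adj c a, adj c b, adj u a & adj u b].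
  by rewrite !(adj_sym b a) !(adj_sym c) !(adj_sym u).
have [uc wc wu wa wb] : [/\ adj u c = false, adj w c, adj w u, adj w a = false & adj w b = false].
  by rewrite !(adj_sym w) (adj_sym u c) cw uw (negbTE cu) (negbTE aw) (negbTE bw).
pose t := [:: w; c; a; b; u].
have ut : uniq t.
  move: u5; rewrite /t /= !inE !negb_or.
  move=> /and5P[/and4P[n1 n2 n3 n4] /and3P[n5 n6 n7] /andP[n8 n9] n10 _].
  by rewrite !(eq_sym w) n9 n4 n7 n10 !(eq_sym c) n2 n5 eq_sym n8 n1 n3 n6.
pose g (i : cycle5') := nth a t i.
apply: (@subgraph_iso B cycle5' g) => //.
- move=> i j /eqP; have lt (k : cycle5') : k < size t by exact: (@ltn_ord 5 k).
  by rewrite /g nth_uniq ?lt // => /eqP; exact: val_inj.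
- by elim/Z5_cases; rewrite SB /g /= !inE eqxx ?orbT.
- by rewrite (eq_card SB); apply: (leq_trans (card_size _)); rewrite card_ord.
elim/Z5_cases; elim/Z5_cases; rewrite /g /= /cycle5'_adj /cycle5_adj /chord ?eq_set2 /=;
  by rewrite ?adj_irrefl ?ab ?ac ?bc ?au ?bu ?ba ?ca ?cb ?ua ?ub ?uc ?cw ?uw ?wc ?wu ?wa ?wb
    ?(negbTE cu) ?(negbTE aw) ?(negbTE bw).
Qed.

End Isomorphisms.

Section Sufficiency.
Variable G : sgraph.
Implicit Types (u v : G) (S : {set G}) (m : {set {set G}}).

Lemma matching_balanced m (c : G -> bool) : is_matching m ->
  {in cover m &, forall u v, adj u v -> c u != c v} ->
  #|[set v in cover m | c v]| = #|[set v in cover m | ~~ c v]|.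
Proof.
move=> mm cc.
have swap v : v \in cover m -> partner m v \in cover m /\ c (partner m v) = ~~ c v.
  move=> vm; have pm := partner_in mm vm.
  have pc : partner m v \in cover m.
    by apply/in_coverP; exists [set v; partner m v]; rewrite // !inE eqxx orbT.
  split=> //; have := cc _ _ vm pc; have := matching_edge mm pm; rewrite edge_pair => -> /(_ isT).
  by case: (c v); case: (c _).
have pI := inv_inj (partnerK mm).
have le (P Q : pred G) : (forall u, u \in cover m -> P u -> Q (partner m u)) ->
    #|[set v in cover m | P v]| <= #|[set v in cover m | Q v]|.
  move=> PQ; rewrite -(card_imset _ pI); apply: subset_leq_card.
  apply/subsetP => v /imsetP[u]; rewrite inE => /andP[um Pu] ->.
  by rewrite inE PQ // (swap u um).1.
apply/eqP; rewrite eqn_leq; apply/andP; split; apply: le => u um cu;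
  by rewrite (swap u um).2 ?cu // negbK.
Qed.

Lemma critical_not_bipartite S (c : G -> bool) : critical S ->
  {in S &, forall u v, adj u v -> c u != c v} -> False.
Proof.
move=> cr cc; have [l [l0 Sl]] := critical_card cr.
have bal v : v \in S -> #|[set u in S | c u] :\ v| = #|[set u in S | ~~ c u] :\ v|.
  move=> vS; have [m mm cm] := cr.2 v vS.
  have := @matching_balanced m c mm; rewrite cm => h.
  have e (P : pred G) : [set u in S | P u] :\ v = [set u in S :\ v | P u].
    by apply/setP => u; rewrite !inE andbA.
  by rewrite (e c) (e (fun u => ~~ c u)); apply: h => a b;
    rewrite !in_setD1 => /andP[_ aS] /andP[_ bS]; exact: cc.
have tot : #|[set u in S | c u]| + #|[set u in S | ~~ c u]| = #|S|.
  rewrite -(cardsID [set u | c u] S); congr (_ + _); apply: eq_card => u; rewrite !inE //.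
  by rewrite andbC.
have one (P : pred G) v : v \in S -> #|[set u in S | P u]| = P v + #|[set u in S | P u] :\ v|.
  by move=> vS; rewrite (cardsD1 v) inE vS.
have [v vS] : exists v, v \in S by apply/card_gt0P; rewrite Sl.
have gen (b : bool) : exists2 w, w \in S & c w = b.
  have := bal v vS; have := one c v vS; have := one (fun u => ~~ c u) v vS => /= h1 h2 h3.
  have : 0 < #|[set u in S | c u == b]|.
    have -> : #|[set u in S | c u == b]| =
        if b then #|[set u in S | c u]| else #|[set u in S | ~~ c u]|.
      by case: b; apply: eq_card => u; rewrite !inE ?eqb_id ?eqbF_neg.
    by move: tot h1 h2 h3; rewrite Sl; case: b; case: (c v) => /=; lia.
  by case/card_gt0P => w; rewrite inE => /andP[wS /eqP]; exists w.
have [w1 w1S c1] := gen true; have [w2 w2S c2] := gen false.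
have := bal w1 w1S; have := bal w2 w2S; have := one c w1 w1S; have := one c w2 w2S.
have := one (fun u => ~~ c u) w1 w1S; have := one (fun u => ~~ c u) w2 w2S.
by rewrite /= c1 c2 /=; lia.
Qed.

Lemma critical3 S : critical S -> #|S| = 3 -> {in S &, forall a b, a != b -> adj a b}.
Proof.
move=> cr S3 a b aS bS ab.
have [v vS] : exists2 v, v \in S & (v != a) && (v != b).
  have /card_gt0P[v] : 0 < #|S :\ a :\ b|.
    have := cardsD1 a S; have := cardsD1 b (S :\ a).
    by rewrite in_setD1 eq_sym ab aS bS S3 /=; lia.
  by rewrite !in_setD1 => /and3P[v1 v2 vS]; exists v; rewrite ?v1 ?v2.
case/andP=> va vb; have [m mm cm] := cr.2 v vS.
have Sv : S :\ v = [set a; b].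
  apply/esym/eqP; rewrite eqEcard cards2 ab subUset !sub1set !in_setD1 aS bS !(eq_sym _ v) va vb.
  by have := cardsD1 v S; rewrite vS S3 /=; lia.
have : a \in cover m by rewrite cm Sv !inE eqxx.
case/in_coverP => e em ae; have eE := matching_edge mm em.
have : e \in star a by rewrite in_star eE.
case/starP => u au eu; have : u \in cover m.
  by apply/in_coverP; exists e; rewrite // eu !inE eqxx orbT.
rewrite cm Sv !inE eq_sym (negbTE (adj_neq au)) /= => /eqP <-; exact: au.
Qed.

Lemma critical3_within S : critical S -> #|S| = 3 -> #|within S| = 3.
Proof.
move=> cr S3; have := handshake S; rewrite (eq_bigr (fun=> 2)) => [|v vS].
  by rewrite sum_nat_const S3; lia.
have -> : [set u in S | adj v u] = S :\ v.
  apply/setP => u; rewrite inE in_setD1 andbC; case uS : (u \in S); rewrite ?andbF ?andbT //.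
  apply/idP/idP => [/adj_neq|uv]; first by rewrite eq_sym.
  by apply: (critical3 cr S3 vS uS); rewrite eq_sym.
by have := cardsD1 v S; rewrite vS S3 /=; lia.
Qed.

Lemma bipartite_unit : bipartite G ->
  (forall u v, essential u -> essential v -> deg u = deg v) ->
  exists2 k, 0 < k & unit_condition G k.
Proof.
move=> [c cc] hd.
have ncr S : critical S -> False.
  by move=> cr; apply: (critical_not_bipartite cr) => u v _ _; exact: cc.
have [[v ev]|no] := EM (exists v, essential v).
  by exists (deg v).+1 => //; split=> [u eu|S l /ncr//]; rewrite (hd u v).
exists 1 => //; split=> [u eu|S l /ncr//]; by case: no; exists u.
Qed.

Lemma cycle5_deg (i : cycle5) : deg i = 2.
Proof.
rewrite /deg -sum1dep_card big_mkcond.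
by elim/Z5_cases: i; rewrite !big_ord_recl big_ord0.
Qed.

Lemma cycle5_triangle_free (i j k : cycle5) : adj i j -> adj j k -> adj i k -> False.
Proof. by elim/Z5_cases: i; elim/Z5_cases: j => //; elim/Z5_cases: k. Qed.

Lemma cycle5_unit : graph_iso G cycle5 -> unit_condition G 3.
Proof.
move=> iso; have [f [bf fadj]] := iso.
have d2 v : deg v = 2 by rewrite -(deg_iso v bf fadj) cycle5_deg.
have cG : #|G| = 5 by rewrite (card_iso iso) card_ord.
split=> [v _|S l cr _ Sl]; first by rewrite d2.
have l0 : 0 < l by have [l' [l'0]] := critical_card cr; rewrite Sl; lia.
have le5 : #|S| <= 5 by rewrite -cG max_card.
have [l1|l2] : l = 1 \/ l = 2 by move: le5; rewrite Sl; lia.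
  have S3 : #|S| = 3 by rewrite Sl l1.
  have /card_gt2P[a [b [d [[aS bS dS] [ab bd da]]]]] : 2 < #|S| by rewrite S3.
  have cl := critical3 cr S3; case: (@cycle5_triangle_free (f a) (f b) (f d)); rewrite fadj.
  - exact: cl.
  - exact: cl.
  - by apply: cl; rewrite // eq_sym.
have ST : S = setT by apply/eqP; rewrite eqEcard subsetT cardsT cG Sl l2.
have := handshake S; rewrite ST (eq_bigr (fun=> 2)) => [|v _]; last first.
  by rewrite -(d2 v) /deg; apply: eq_card => u; rewrite !inE.
by rewrite sum_nat_const cardsT cG l2; lia.
Qed.

Lemma subgraph_deg (B : subgraph G) (x : graph_of_subgraph B) : block B ->
  deg x = #|[set u in sub_vertices B | adj (val x) u]|.
Proof.
move=> bB; rewrite /deg -(card_imset _ val_inj); apply: eq_card => u.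
rewrite !inE; apply/imsetP/andP => [[y]|[uB xu]].
  rewrite inE => xy ->; split; first exact: valP.
  by rewrite -(block_induced bB (valP x) (valP y)).
exists (Sub u uB); rewrite ?SubK // inE /=.
by have := block_induced bB (valP x) uB; rewrite xu.
Qed.

Lemma cycle5'_sum_deg : \sum_(i : cycle5') deg i = 14.
Proof.
have -> : 14 = \sum_(i < 5) nth 0 [:: 2; 3; 3; 3; 3] i by rewrite !big_ord_recl big_ord0.
apply: eq_bigr => i _; rewrite /deg -sum1dep_card big_mkcond.
elim/Z5_cases: i; rewrite !big_ord_recl big_ord0 /= /cycle5'_adj /cycle5_adj /Defs.chord
  ?eq_set2 //.
Qed.

Lemma blocks_unit :
  (forall u : G, essential u -> deg u = 3) ->
  (forall B : subgraph G, block B ->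
     let H := graph_of_subgraph B in
     [\/ bipartite H, graph_iso H (complete_graph 3),
         graph_iso H (complete_graph 4)
       | graph_iso H (complete_multipartite [:: 1; 1; 2]) \/
         graph_iso H cycle5']) ->
  unit_condition G 4.
Proof.
move=> d3 hB; split=> [v /d3->//|S l cr nc Sl].
have [l' [l'0 Sl']] := critical_card cr.
have l0 : 0 < l by move: Sl'; rewrite Sl; lia.
have exS : exists v, v \in S by apply/card_gt0P; rewrite Sl.
have [B bB SB] := block_containing exS nc.
have le : #|S| <= #|graph_of_subgraph B| by rewrite card_subgraph subset_leq_card.
have case3 : #|S| <= 4 -> #|within S|.+1 = 4 * l.
  move=> S4; have l1 : l = 1 by move: S4; rewrite Sl; lia.
  have S3 : #|S| = 3 by rewrite Sl l1.
  by rewrite (critical3_within cr S3) l1.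
case: (hB B bB) => [[c cc]|iso|iso|[iso|iso]].
- pose c' v := if insub v is Some x then c (x : graph_of_subgraph B) else false.
  case: (@critical_not_bipartite S c' cr) => u v uS vS uv.
  have uB := subsetP SB _ uS; have vB := subsetP SB _ vS.
  rewrite /c' !insubT; apply: cc.
  by have := block_induced bB uB vB; rewrite uv.
- by apply: case3; apply: (leq_trans le); rewrite (card_iso iso) card_ord.
- by apply: case3; apply: (leq_trans le); rewrite (card_iso iso) card_ord.
- apply: case3; apply: (leq_trans le); rewrite (card_iso iso).
  by rewrite card_tagged sumnE big_map big_enum !big_ord_recl big_ord0 /= !card_ord.
have c5 : #|graph_of_subgraph B| = 5 by rewrite (card_iso iso) card_ord.
rewrite c5 in le; have [S4|S5] := leqP #|S| 4; first exact: case3.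
have l2 : l = 2 by move: S5 le; rewrite Sl; lia.
have SBe : S = sub_vertices B.
  by apply/eqP; rewrite eqEcard SB -card_subgraph c5.
have := handshake S; have := sum_deg_iso iso; rewrite cycle5'_sum_deg.
rewrite (eq_bigr (fun x => #|[set u in sub_vertices B | adj (val x) u]|)) => [|x _]; last first.
  exact: subgraph_deg.
rewrite -(big_sub (mem (sub_vertices B)) (fun v => #|[set u in sub_vertices B | adj v u]|)) SBe.
by move=> -> h; rewrite l2; lia.
Qed.

End Sufficiency.

Section Necessity.
Variable G : sgraph.
Hypothesis connG : connected_graph G.
Variable k : nat.
Hypothesis ess : forall v : G, essential v -> (deg v).+1 = k.
Hypothesis odd_count : forall p : seq G, uniq p -> cycle adj p -> odd (size p) ->
  #|within [set v in p]|.+1 = k * (size p)./2.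

Lemma chordless_count (p : seq G) : cycle adj p -> odd (size p) -> uniq p ->
  (forall x, x \in p -> #|[set y in p | adj x y]| = 2) ->
  k = 4 /\ size p = 3 \/ k = 3 /\ size p = 5.
Proof.
move=> cp op up d2; have := odd_count up cp op.
have : #|within [set v in p]| = size p.
  have := handshake [set v in p]; rewrite (eq_bigr (fun=> 2)) => [|v].
    by rewrite sum_nat_const cardsE (card_uniqP up); lia.
  rewrite inE => vp; rewrite -(d2 v vp); apply: eq_card => u; by rewrite !inE.
move=> ->; have := odd_double_half (size p); rewrite op add1n.
have : size p != 1.
  by apply/eqP; case: (p) cp => [|a [|b q]] //=; rewrite adj_irrefl.
move: (size p) (size p)./2 => n l n1 nl; subst n.
case: l n1 => [|[|[|l]]] // _ h; [left|right|]; try by split; lia.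
by case: k h => [|[|[|[|k']]]] h; nia.
Qed.

Lemma five_cycle_iso (p : seq G) : cycle adj p -> odd (size p) ->
  (forall q : seq G, cycle adj q -> odd (size q) -> size p <= size q) ->
  k = 3 -> size p = 5 -> graph_iso G cycle5.
Proof.
move=> cp op mp k3 sp; have up := minimal_uniq cp op mp.
have d2 := minimal_degree (@adj_sym G) (@adj_irrefl G) cp op mp.
have ch := minimal_chordless (@adj_sym G) cp op mp.
have closed (x y : G) : x \in p -> adj x y -> y \in p.
  move=> xp xy; have sub : [set v in p | adj x v] \subset [set v | adj x v].
    by apply/subsetP => v; rewrite !inE => /andP[].
  have dx : deg x = 2.
    have le : 2 <= deg x by rewrite -(d2 x xp) subset_leq_card.
    apply/eqP; rewrite eqn_leq le andbT leqNgt; apply/negP => d3.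
    by have := ess (Or33 _ _ d3); rewrite k3 => -[e]; rewrite e in d3.
  have : y \in [set v | adj x v] by rewrite inE.
  have -> : [set v | adj x v] = [set v in p | adj x v].
    by apply/esym/eqP; rewrite eqEcard sub (d2 x xp) -/(deg x) dx.
  by rewrite inE => /andP[].
have cs : connect_sym (@adj G) by apply: sym_connect_sym; exact: adj_sym.
have [_ call] := (n_comp_eq1 cs).1 connG.
have all v : v \in p.
  have [x xp] : exists x, x \in p by case: (p) sp => // x s _; exists x; rewrite inE eqxx.
  apply/negPn/negP => vp.
  have [||u [w [uw]]] := @connect_exit G (@adj G) x v [set y in p] (call x v); rewrite ?inE //.
  by move=> uS /negP; apply; exact: closed uS uw.
case: p sp cp op mp up d2 ch closed all => [|p0 [|p1 [|p2 [|p3 [|p4 [|? ?]]]]]] // _ cp op mp up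
  d2 ch closed all.
move: (up); rewrite /= !inE !negb_or.
move=> /and5P[/and4P[n1 n2 n3 n4] /and3P[n5 n6 n7] /andP[n8 n9] n10 _].
move: (cp) => /= /and5P[a01 a12 a23 a34 /andP[a40 _]].
have ch0 y := @ch 0 p0 [:: p1; p2; p3; p4] y erefl.
have ch1 y := @ch 1 p1 [:: p2; p3; p4; p0] y erefl.
have ch2 y := @ch 2 p2 [:: p3; p4; p0; p1] y erefl.
have a02 : adj p0 p2 = false.
  apply/negP => /(ch0 _ _)[]; rewrite ?inE ?eqxx ?orbT //= => e.
    by rewrite e eqxx in n5.
  by rewrite e eqxx in n9.
have a03 : adj p0 p3 = false.
  apply/negP => /(ch0 _ _)[]; rewrite ?inE ?eqxx ?orbT //= => e.
    by rewrite e eqxx in n6.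
  by rewrite e eqxx in n10.
have a13 : adj p1 p3 = false.
  apply/negP => /(ch1 _ _)[]; rewrite ?inE ?eqxx ?orbT //= => e.
    by rewrite e eqxx in n8.
  by rewrite e eqxx in n3.
have a14 : adj p1 p4 = false.
  apply/negP => /(ch1 _ _)[]; rewrite ?inE ?eqxx ?orbT //= => e.
    by rewrite e eqxx in n9.
  by rewrite e eqxx in n4.
have a24 : adj p2 p4 = false.
  apply/negP => /(ch2 _ _)[]; rewrite ?inE ?eqxx ?orbT //= => e.
    by rewrite e eqxx in n10.
  by rewrite e eqxx in n7.
apply: graph_iso_sym; pose t := [:: p0; p1; p2; p3; p4].
have lt (i : cycle5) : i < size t by exact: (@ltn_ord 5 i).
exists (fun i : cycle5 => nth p0 t i); split.
  apply: inj_card_bij.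
    by move=> i j /eqP; rewrite nth_uniq ?lt // => /eqP; exact: val_inj.
  rewrite card_ord; apply: (leq_trans _ (card_size t)); apply: subset_leq_card.
  by apply/subsetP => v _; exact: all.
elim/Z5_cases; elim/Z5_cases => /=; rewrite ?adj_irrefl ?a01 ?a12 ?a23 ?a34 ?a40 ?a02 ?a03 ?a13
  ?a14 ?a24 // adj_sym ?a01 ?a12 ?a23 ?a34 ?a40 ?a02 ?a03 ?a13 ?a14 ?a24 //.
Qed.

Lemma block_type (B : subgraph G) : k = 4 -> block B ->
  let H := graph_of_subgraph B in
  [\/ bipartite H, graph_iso H (complete_graph 3), graph_iso H (complete_graph 4)
    | graph_iso H (complete_multipartite [:: 1; 1; 2]) \/ graph_iso H cycle5'].
Proof.
move=> k4 bB /=; set V := sub_vertices B; pose e := restr (@adj G) V.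
have [bip|nbip] := EM (bipartite (graph_of_subgraph B)); first by constructor 1.
have es : symmetric e by apply: restr_sym; exact: adj_sym.
have ei : irreflexive e by move=> x; rewrite /e /restr adj_irrefl.
have [|p [cp op mp]] := not_colorable_minimal es.
  case=> c cc; apply: nbip; exists (fun x => c (val x)) => u v uv; apply: cc.
  rewrite /e /restr (valP u) (valP v) !andbT.
  by rewrite -(block_induced bB (valP u) (valP v)).
have up := minimal_uniq cp op mp.
have d2 := minimal_degree es ei cp op mp.
have cp' : cycle adj p by apply: sub_cycle cp => u v /and3P[].
have pV x : x \in p -> x \in V.
  move=> xp; have : #|[set y in p | e x y]| = 2 by exact: d2.
  move=> c2; have /card_gt0P[y] : 0 < #|[set y in p | e x y]| by rewrite c2.
  by rewrite inE => /andP[_ /and3P[]].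
have [|[_ p3]|[k3 _]] := chordless_count cp' op up; last by rewrite k4 in k3.
  move=> x xp; rewrite -(d2 x xp); apply: eq_card => y; rewrite !inE /e /restr.
  by case yp : (y \in p) => //=; rewrite (pV x) // (pV y) // !andbT.
case: p p3 cp cp' op up pV {mp d2} => [|x [|y [|z [|? ?]]]] // _ cp cp' op up pV.
move: cp' => /= /and4P[xy yz zx _].
have xz : adj x z by rewrite adj_sym.
have nV : noncut adj V by apply: noncut_vertices; case: bB.
have deg3 (v : G) : deg v <= 3.
  rewrite leqNgt; apply/negP => d4; have d3 : 3 <= deg v by exact: ltnW.
  by have := @ess v (Or33 _ _ d3); rewrite k4 => -[e3]; rewrite e3 in d4.
have oc (q : seq G) : uniq q -> cycle adj q -> odd (size q) ->
    #|within [set v in q]|.+1 = 4 * (size q)./2 by have := @odd_count q; rewrite k4.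
case: (classify_triangle deg3 oc nV pV xy xz yz) => [V3|[a [b [c [u [V4|K|[w C]]]]]]].
- constructor 2; apply: (@clique_iso G B [:: x; y; z] x) => // s t.
  have yx : adj y x by rewrite adj_sym.
  have zy : adj z y by rewrite adj_sym.
  by rewrite !inE => /or3P[]/eqP-> /or3P[]/eqP->; rewrite ?eqxx.
- case: V4 => V4 [ab ac bc [au bu cu]]; constructor 3.
  have [ba ca cb] : [/\ adj b a, adj c a & adj c b] by rewrite (adj_sym b) !(adj_sym c).
  have [ua ub uc] : [/\ adj u a, adj u b & adj u c] by rewrite !(adj_sym u).
  apply: (@clique_iso G B [:: a; b; c; u] a) => //.
    by rewrite /= !inE !negb_or !adj_neq.
  by move=> s t; rewrite !inE => /or4P[]/eqP-> /or4P[]/eqP->; rewrite ?eqxx.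
- by constructor 4; left; exact: K112_iso K.
- by constructor 4; right; exact: C5'_iso C.
Qed.

End Necessity.

Theorem theorem3p3 (R : realType) (G : sgraph) (connG : connected_graph G) :
  gorenstein (matching_polytope R G) <->
  [\/ bipartite G /\
        (forall u v : G, essential u -> essential v -> deg u = deg v),
      graph_iso G cycle5
    | (forall u : G, essential u -> deg u = 3) /\
      (forall B : subgraph G, block B ->
         let H := graph_of_subgraph B in
         [\/ bipartite H, graph_iso H (complete_graph 3),
             graph_iso H (complete_graph 4)
           | graph_iso H (complete_multipartite [:: 1; 1; 2]) \/
             graph_iso H cycle5'])].
Proof.
split=> [/gorenstein_necessary[k k0 [ess oc]]|[[bip hd]|iso|[d3 hB]]]; last first.
- by apply: (@gorenstein_suff _ _ 4) => //; exact: blocks_unit.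
- by apply: (@gorenstein_suff _ _ 3) => //; exact: cycle5_unit.
- by have [k k0 uk] := bipartite_unit bip hd; exact: gorenstein_suff uk.
have [bip|nbip] := EM (bipartite G).
  by constructor 1; split=> // u v eu ev; apply: succn_inj; rewrite (ess u eu) (ess v ev).
have [p [cp op mp]] := not_colorable_minimal (@adj_sym G) nbip.
have up := minimal_uniq cp op mp.
have d2 := minimal_degree (@adj_sym G) (@adj_irrefl G) cp op mp.
have [[k4 _]|[k3 sp]] := chordless_count oc cp op up d2.
  constructor 3; split=> [u /ess|B]; first by rewrite k4 => -[].
  exact: block_type ess oc _ k4.
constructor 2; exact: five_cycle_iso connG _ ess _ cp op mp k3 sp.
Qed.
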